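(* Let $G$ be a group definable in a first order structure $M$. If $G$ is definably amenable, then ${G^*}^{00}_M={G^*}^{000}_M$.
   Context: $\mathfrak C\succ M$ is a monster model ($\kappa$-saturated and strongly $\kappa$-homogeneous for a sufficiently large strong limit cardinal $\kappa$) and $G^*$ is the interpretation of $G$ in $\mathfrak C$. ''Bounded index'' means index $<\kappa$. ${G^*}^{00}_M$ is the smallest bounded index subgroup of $G^*$ which is type-definable over $M$ (an intersection of sets definable over $M$); ${G^*}^{000}_M$ is the smallest bounded index subgroup of $G^*$ which is invariant under $\mathrm{Aut}(\mathfrak C/M)$. $G$ is definably amenable if there is a left-invariant finitely additive probability measure on the Boolean algebra of all subsets of $G$ definable in $M$ (with parameters). *)

(* Defs.v *)
From mathcomp Require Import all_boot all_order all_algebra.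
From mathcomp Require Import boolp classical_sets functions cardinality reals.

Set Implicit Arguments.
Unset Strict Implicit.
Unset Printing Implicit Defensive.

Local Open Scope classical_set_scope.
Local Open Scope card_scope.

Record language : Type := Language {
  fun_sym : Type;
  fun_ar : fun_sym -> nat;
  rel_sym : Type;
  rel_ar : rel_sym -> nat }.

(* The type parameter [V] is the set of free variables; a quantifier binds the
   new variable [None] of [option V].  Hence [formula L (V + P)] is the set of
   formulas in the variables [V] with parameters named by [P]. *)
Inductive term (L : language) (V : Type) : Type :=
| Var of V
| App (f : fun_sym L) of ('I_(fun_ar f) -> term L V).

Inductive formula (L : language) (V : Type) : Type :=
| Eq of term L V & term L V
| Rel (r : rel_sym L) of ('I_(rel_ar r) -> term L V)
| Not of formula L V
| And of formula L V & formula L V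
| Ex of formula L (option V).

Record structure (L : language) : Type := Structure {
  carrier :> Type;
  carrier_inhabited : inhabited carrier;
  interp_fun : forall f : fun_sym L, ('I_(fun_ar f) -> carrier) -> carrier;
  interp_rel : forall r : rel_sym L, ('I_(rel_ar r) -> carrier) -> Prop }.

Section Semantics.
Variables (L : language) (N : structure L).

Fixpoint eval (V : Type) (e : V -> N) (t : term L V) : N :=
  match t with
  | Var v => e v
  | App f ts => interp_fun (fun k => eval e (ts k))
  end.

Definition extend (V : Type) (e : V -> N) (a : N) : option V -> N :=
  fun v => if v is Some w then e w else a.

Fixpoint sat (V : Type) (e : V -> N) (phi : formula L V) : Prop :=
  match phi with
  | Eq s t => eval e s = eval e t
  | Rel r ts => interp_rel (fun k => eval e (ts k))
  | Not phi => ~ sat e phi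
  | And phi psi => sat e phi /\ sat e psi
  | Ex phi => exists a : N, sat (extend e a) phi
  end.

Definition join (V W : Type) (e : V -> N) (p : W -> N) : V + W -> N :=
  fun v => match v with inl x => e x | inr y => p y end.

Definition automorphism (s : N -> N) : Prop :=
  [/\ bijective s,
      forall (f : fun_sym L) (a : 'I_(fun_ar f) -> N),
        s (interp_fun a) = interp_fun (fun k => s (a k))
    & forall (r : rel_sym L) (a : 'I_(rel_ar r) -> N),
        interp_rel a <-> interp_rel (fun k => s (a k))].

End Semantics.

Definition elementary_embedding (L : language) (M N : structure L)
    (i : M -> N) : Prop :=
  forall (V : Type) (e : V -> M) (phi : formula L V),
    sat e phi <-> sat (fun v => i (e v)) phi.

(* A cardinal is represented by a type [K] of that cardinality. *)

Definition card_lt (T U : Type) (A : set T) (B : set U) : Prop :=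
  A #<= B /\ ~ (B #<= A).

Definition strong_limit (K : Type) : Prop :=
  forall T : Type,
    card_lt [set: T] [set: K] -> card_lt [set: set T] [set: K].

Definition sufficiently_large (K : Type) (L : language) (M : structure L) :
    Prop :=
  [/\ card_lt [set: nat] [set: K],
      card_lt [set: fun_sym L] [set: K],
      card_lt [set: rel_sym L] [set: K]
    & card_lt [set: M] [set: K]].

Section Monster.
Variables (K : Type) (L : language) (C : structure L).

Definition saturated : Prop :=
  forall (A : set C) (n : nat) (p : set (formula L ('I_n + A))),
    card_lt A [set: K] ->
    (forall q, finite_set q -> q `<=` p ->
      exists c : 'I_n -> C, forall phi, q phi -> sat (join c val) phi) ->
    exists c : 'I_n -> C, forall phi, p phi -> sat (join c val) phi.

Definition strongly_homogeneous : Prop :=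
  forall (A : set C) (f : A -> C),
    card_lt A [set: K] ->
    (forall phi : formula L A, sat (N := C) val phi <-> sat f phi) ->
    exists s : C -> C, automorphism s /\ forall a : A, s (val a) = f a.

Definition monster (M : structure L) (i : M -> C) : Prop :=
  [/\ elementary_embedding i, saturated & strongly_homogeneous].

End Monster.

(* In [N], with the parameters [P] interpreted by [p], [phi] defines a subset
   of [N^n] and [mu] the graph of an operation on it; this group is identified
   with [G] by the coordinate map [x].  Using the same [phi] and [mu] in [M] and
   in an elementary extension gives a definable group and its interpretation
   there. *)
Record defines_group (L : language) (N : structure L) (P : Type) (p : P -> N)
    (n : nat) (phi : formula L ('I_n + P))
    (mu : formula L ('I_n + 'I_n + 'I_n + P))
    (G : groupType) (x : G -> 'I_n -> N) : Prop := DefinesGroup {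
  coord_inj : injective x;
  coord_range : range x = [set a | sat (join a p) phi];
  coord_mul : forall g h k : G,
    sat (join (join (join (x g) (x h)) (x k)) p) mu <-> (g * h)%g = k }.

Section GroupNotions.
Variables (L : language) (N : structure L) (P : Type) (p : P -> N).
Variables (n : nat) (G : groupType) (x : G -> 'I_n -> N).

(* The definable subsets of a definable group [G] are the traces on [G] of the
   definable subsets of the ambient Cartesian power. *)
Definition definable (X : set G) : Prop :=
  exists psi : formula L ('I_n + P), X = [set g | sat (join (x g) p) psi].

Definition type_definable (X : set G) : Prop :=
  exists F : set (set G), F `<=` definable /\ X = \bigcap_(Y in F) Y.

Definition invariant (X : set G) : Prop :=
  forall s : N -> N, automorphism s -> (forall m, s (p m) = p m) ->
    [set (fun k => s (a k)) | a in x @` X] = x @` X.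

End GroupNotions.

Definition left_translate (G : groupType) (g : G) (X : set G) : set G :=
  [set (g * h)%g | h in X].

Definition is_subgroup (G : groupType) (H : set G) : Prop :=
  [/\ H 1%g, forall g h, H g -> H h -> H (g * h)%g
    & forall g, H g -> H (g^-1)%g].

Definition bounded_index (K : Type) (G : groupType) (H : set G) : Prop :=
  card_lt [set left_translate g H | g in [set: G]] [set: K].

Definition is_least (T : Type) (Q : set (set T)) (X : set T) : Prop :=
  Q X /\ forall Y, Q Y -> X `<=` Y.

Section Components.
Variables (K : Type) (L : language) (M C : structure L) (i : M -> C).
Variables (n : nat) (G : groupType) (x : G -> 'I_n -> C).

Definition is_G00 : set G -> Prop :=
  is_least [set H : set G |
    [/\ is_subgroup H, bounded_index K H & type_definable i x H]].

Definition is_G000 : set G -> Prop :=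
  is_least [set H : set G |
    [/\ is_subgroup H, bounded_index K H & invariant i x H]].

End Components.

(* [m] is only constrained on the subsets definable with parameters in [M]. *)
Definition definably_amenable (R : realType) (L : language) (M : structure L)
    (n : nat) (G : groupType) (x : G -> 'I_n -> M) : Prop :=
  let def := definable (@id M) x in
  exists m : set G -> R,
    [/\ m [set: G] = 1%R,
        forall X, def X -> (0 <= m X)%R,
        forall X Y, def X -> def Y -> X `&` Y = set0 ->
          m (X `|` Y) = (m X + m Y)%R
      & forall (g : G) X, def X -> m (left_translate g X) = m X].

(* Main.v *)
Require Import Defs.
From mathcomp Require Import all_boot all_order all_algebra.
From mathcomp Require Import boolp classical_sets functions cardinality reals.
From mathcomp Require Import filter wochoice.
From mathcomp Require Import ring lra zify.

(** Call two elements of [Gstar] similar if they have the same type over [M], and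
    let [S] be the set of the quotients [a^-1 * b] of similar elements.  For a
    finite list of formulas over [M], let [Q] be the [M]-definable set of the
    [a^-1 * b] such that [a] and [b] agree on the list.  The proof shows that the
    set [S^4] of products of four elements of [S] is a subgroup that lies
    between the two components:

    - an invariant subgroup of bounded index contains [S]: a sufficiently long
      coheir sequence in the type of [a] has two terms in one coset, and the type
      of such a pair is also the type of a pair that starts with [a]
      ([invariant_same]);
    - by saturation [S^4] is the intersection of the sets [Q^4] ([prod4_same]), so
      it is type-definable over [M], and its cosets are determined by types, so
      it has bounded index;
    - every product of elements of [S] lies in every [Q^4] ([sametype_prod]),
      so [S^4] is closed under products.

    Hence [H00] is contained in [S^4] and [S^4] in [H000]; conversely [H000] is
    contained in [H00] because type-definable sets are invariant.

    Amenability is used in the last point, through an argument of Massicot and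
    Wagner.  Finitely many translates of [Q] cover the group, say [k] of them, so
    [D Q] has measure at least [1 / k] for every nonempty [D].  Let [D] have measure [t], and
    suppose that every subset of [D] of measure at least [t'], where [t'] is much
    smaller than [t], has a product with [Q] almost as large as [D Q].  If [g D]
    meets [D] in measure at least [t'], then [g] moves [D Q] very little, and a
    product of boundedly many such [g] still does not make [D Q] disjoint from
    itself; the product therefore lies in [D Q Q D^-1], that is, in [Q^4] if [D]
    is a subset of [Q].  By the pigeonhole principle finitely many translates of
    the set of these [g] cover the group.  If that set were definable over [M],
    two similar elements would lie in a common translate of it, and the quotient
    of the two would be a product of two such [g] or inverses, which gives the
    claim.

    The set has to be made definable although the measure is not.  First, the
    measure is replaced by all finite sequences of points of the group, with
    their counting measures, that are almost invariant under finitely many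
    translations ([passes]); that for every choice of [n] translations there is
    such a sequence for which [g D] meets [D] in a given proportion is a
    first-order property of [g] ([quasi_stab], [dset_quasi_stab]).  The letters
    of a product may come with different sequences, but concatenating them
    averages the measures, which divides the proportion by the length of the
    product only ([quasi_stab_prod]).  Second, [D] is taken among the
    intersections of translates of [Q], so that the intersection of [D] and
    [g D] is of the same form, and the existence of a good [D] results from
    going through a bounded number of thresholds, where at some stage the least
    measure of [D Q] does not drop ([exists_quasi_stab]).  Elementarity then
    carries the resulting definable set from [M] to the monster model. *)

Set Implicit Arguments.
Unset Strict Implicit.
Unset Printing Implicit Defensive.

Local Open Scope classical_set_scope.

Section Combinatorics.
Import Order.TTheory GRing.Theory Num.Theory.

(** * Counting in a finite sequence *)

Section Count.
Variable T : Type.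
Implicit Types (S : set T) (x : seq T).

Definition cnt S x := count (fun y => `[< S y >]) x.

Lemma cnt_cat S x y : cnt S (x ++ y) = cnt S x + cnt S y.
Proof. exact: count_cat. Qed.

Lemma cnt_le S S' x : S `<=` S' -> cnt S x <= cnt S' x.
Proof. by move=> sS; apply: sub_count => y /asboolP/sS/asboolP. Qed.

Lemma cnt_size S x : cnt S x <= size x.
Proof. exact: count_size. Qed.

Lemma cnt_cons S y x : cnt S (y :: x) = (`[< S y >] : nat) + cnt S x.
Proof. by []. Qed.

Lemma cntU S S' x : cnt (S `|` S') x <= cnt S x + cnt S' x.
Proof.
elim: x => // y x IH; rewrite !cnt_cons.
have : (`[< (S `|` S') y >] : nat) <= (`[< S y >] : nat) + (`[< S' y >] : nat).
  by case: asboolP => // -[/asboolP ->|/asboolP ->] //; rewrite addn1.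
lia.
Qed.

Lemma cntD S S' x : cnt S x = cnt (S `&` S') x + cnt (S `\` S') x.
Proof.
elim: x => // y x IH; rewrite !cnt_cons IH.
suff -> : (`[< S y >] : nat) =
    (`[< (S `&` S') y >] : nat) + (`[< (S `\` S') y >] : nat) by lia.
rewrite asbool_and; have -> : `[< (S `\` S') y >] = `[< S y >] && ~~ `[< S' y >].
  by rewrite asbool_and asbool_neg.
by case: `[< S y >]; case: `[< S' y >].
Qed.

Lemma cnt_ex S x : 0 < cnt S x -> exists y, S y.
Proof.
elim: x => // y x IH; rewrite cnt_cons; case: asboolP => [Sy _|_ /IH //].
by exists y.
Qed.

Lemma cnt_set0 x : cnt set0 x = 0.
Proof. by elim: x => // y x IH; rewrite cnt_cons IH asboolF. Qed.

Lemma cnt_setT x : cnt setT x = size x.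
Proof. by elim: x => // y x IH; rewrite cnt_cons IH asboolT. Qed.

End Count.

Lemma cnt_cover (T : Type) (I : eqType) (F : I -> set T) (s : seq I)
    (x : seq T) :
  (forall y, exists2 i, i \in s & F i y) ->
  size x <= \sum_(i <- s) cnt (F i) x.
Proof.
move=> cov; elim: x => // y x IH; rewrite [size _]/=.
under eq_bigr do rewrite cnt_cons.
rewrite big_split /= -[(size x).+1]add1n leq_add //.
have [i si Fi] := cov y; elim: s si {cov IH} => //= j s IH.
rewrite inE big_cons => /predU1P[<-|/IH]; first by rewrite (asboolT Fi).
by move/leq_trans; apply; rewrite leq_addl.
Qed.

(** With [q] the number of the sets that contain a given point, this is
    [q <= 1 + q (q - 1) / 2], summed over the points of [x]. *)
Lemma cnt_pairs (T : Type) (p : nat) (F : nat -> set T) (x : seq T) :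
  \sum_(i < p) cnt (F i) x <=
    size x + \sum_(l < p) \sum_(i < l) cnt (F i `&` F l) x.
Proof.
elim: x => [|y x IH].
  by rewrite big1 // => i _.
under eq_bigr do rewrite cnt_cons.
under [X in _ <= _ + X]eq_bigr => l _.
  under eq_bigr do rewrite cnt_cons.
  rewrite big_split /=; over.
rewrite !big_split /= -[(size x).+1]add1n addnACA leq_add //.
elim: p {IH} => [|p IH]; first by rewrite big_ord0.
rewrite !big_ord_recr /=.
have [Fp|nFp] := asboolP (F p y); last by lia.
set q := \sum_(i < p) _ in IH *; set r := (X in _ <= 1 + X) in IH.
suff -> : \sum_(i < p) `[< (F i `&` F p) y >] = q by lia.
apply: eq_bigr => i _; congr nat_of_bool.
by rewrite asbool_and (asboolT Fp) andbT.
Qed.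

(** * Translates of a generic set *)

Section Words.

(** A finite test set [H] of translations also provides the finitely many sets
    to be translated, through the words of bounded length in [H]. *)
Fixpoint words (T : Type) (H : seq T) (l : nat) : seq (seq T) :=
  if l is l'.+1 then [::] :: [seq h :: w | h <- H, w <- words H l']
  else [:: [::]].

Lemma mem_words (T : eqType) (H : seq T) l w :
  (w \in words H l) = (size w <= l) && all (mem H) w.
Proof.
elim: l w => [|l IH] [|a w] //=; rewrite inE /=.
apply/allpairsP/idP => [[[h v] /= [hH vw [-> ->]]]|].
  by move: vw; rewrite IH ltnS hH.
rewrite ltnS andbCA => /andP[aH aw]; exists (a, w); split => //=.
by rewrite IH.
Qed.

Lemma map_words (T U : Type) (f : T -> U) (H : seq T) l :
  words (map f H) l = map (map f) (words H l).
Proof.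
elim: l => //= l IH; congr (_ :: _); rewrite IH.
by rewrite map_allpairs allpairs_mapl allpairs_mapr.
Qed.

Lemma size_words (T U : Type) (H : seq T) (H' : seq U) l :
  size H = size H' -> size (words H l) = size (words H' l).
Proof. by move=> e; elim: l => //= l IH; rewrite !size_allpairs e IH. Qed.

End Words.

Section Translates.
Variables (G : groupType) (A : set G).
Implicit Types (c w H x : seq G) (g h u v y : G).
Local Open Scope group_scope.

(** The family of these sets is closed under intersection and under left
    translation, and for words of bounded length it is uniformly definable. *)
Fixpoint cap c : set G :=
  if c is a :: c' then [set y | A (a^-1 * y) /\ cap c' y] else setT.

Definition capA c : set G := [set y | exists d, cap c d /\ A (d^-1 * y)].

Definition tr g S : set G := [set y | S (g^-1 * y)].

Lemma capP c y : cap c y <-> {in c, forall a, A (a^-1 * y)}.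
Proof.
elim: c => [|a c IH] /=; first by split.
rewrite IH; split=> [[Aa Ac] b|Ac].
  by rewrite inE => /predU1P[->//|]; apply: Ac.
split=> [|b bc]; apply: Ac; rewrite inE ?eqxx // bc orbT //.
Qed.

Lemma cap_cat c c' : cap (c ++ c') = cap c `&` cap c'.
Proof.
apply/seteqP; split=> y; rewrite /= !capP.
  by move=> e; split=> a ac; apply: e; rewrite mem_cat ac ?orbT.
by move=> [e e'] a; rewrite mem_cat => /orP[/e|/e'].
Qed.

Lemma cap_tr g c : cap (map (fun a => g * a) c) = tr g (cap c).
Proof.
apply/seteqP; split=> y; rewrite /= capP /tr /= capP => e a.
  move=> ac; have := e (g * a) (map_f _ ac).
  by rewrite invgM mulgA.
by move=> /mapP[b bc ->]; rewrite invgM -mulgA; apply: e.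
Qed.

Lemma capA_tr g c : capA (map (fun a => g * a) c) = tr g (capA c).
Proof.
rewrite /capA cap_tr /tr; apply/seteqP; split=> y /= [d [cd Ad]].
  by exists (g^-1 * d); split=> //; rewrite invgM invgK -mulgA mulVKg.
by exists (g * d); rewrite mulKg; split=> //; rewrite invgM -mulgA.
Qed.

Lemma capA_sub c c' : cap c `<=` cap c' -> capA c `<=` capA c'.
Proof. by move=> s y [d [/s cd Ad]]; exists d. Qed.

Lemma trM g h S : tr (g * h) S = tr g (tr h S).
Proof. by apply/seteqP; split=> y; rewrite /tr /= invgM mulgA. Qed.

Lemma tr1 S : tr 1 S = S.
Proof. by apply/seteqP; split=> y; rewrite /tr /= invg1 mul1g. Qed.

Lemma cap1 g : cap [:: g] = tr g A.
Proof. by apply/seteqP; split=> y //= []. Qed.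

Lemma cap_nseq1 n : cap (nseq n.+1 1) = A.
Proof.
apply/seteqP; split=> y; first by rewrite /= invg1 mul1g => -[].
move=> Ay; apply/capP => a; rewrite mem_nseq => /eqP ->.
by rewrite invg1 mul1g.
Qed.

End Translates.

(** * Almost invariant finite sequences *)

Lemma size_flatten_map (T U : Type) (f : T -> seq U) (s : seq T) k :
  (forall a, size (f a) = k) -> size (flatten (map f s)) = size s * k.
Proof. by move=> e; elim: s => //= a s IH; rewrite size_cat e IH mulSn. Qed.

Lemma sub_pad (T : eqType) (a : T) (H : seq T) n : size H <= n ->
  exists2 H', size H' = n & {subset H <= H'}.
Proof.
move=> Hn; exists (H ++ nseq (n - size H) a).
  by rewrite size_cat size_nseq subnKC.
by move=> b bH; rewrite mem_cat bH.
Qed.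

Section Almost.
Variables (R : realType) (G : groupType) (A : set G).
Implicit Types (c H x : seq G) (g h u v w y : G) (S E : set G).
Local Open Scope group_scope.

Local Notation "S # x" := ((cnt S x)%:R%R : R) (at level 20).
Local Notation "x '.size'" := ((size x)%:R%R : R) (at level 2).

Definition near_inv (dl : R) (F : seq G -> set G) h c x :=
  (`| F (map (fun a => h * a)%g c) # x - F c # x | <= dl * x.size)%R.

(** The counting measure of [x] is invariant up to [dl] under the translations
    in [H], for the sets described by words in [H]. *)
Definition passes dl l H x := forall h c, h \in H -> c \in words H l ->
  near_inv dl (cap A) h c x /\ near_inv dl (capA A) h c x.

Lemma passes_sub dl l H H' x : {subset H <= H'} ->
  passes dl l H' x -> passes dl l H x.
Proof.
move=> s p h c /s hH; rewrite mem_words => /andP[cl /allP cH].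
apply: p => //; rewrite mem_words cl; apply/allP => a /cH; exact: s.
Qed.

Lemma passes_flatten dl l H (T : eqType) (s : seq T) (f : T -> seq G) :
  {in s, forall a, passes dl l H (f a)} ->
  passes dl l H (flatten (map f s)).
Proof.
move=> p h c hH cH; rewrite /near_inv; elim: s p => [|a s IH] p.
  by rewrite /= mulr0 subrr normr0.
have [p1 p2] := p a (mem_head _ _) h c hH cH.
have {IH}[|q1 q2] := IH; first by move=> b bs; apply: p; rewrite inE bs orbT.
rewrite /= !cnt_cat size_cat !natrD.
move: p1 p2 q1 q2; rewrite /near_inv !ler_norml => /andP[? ?] /andP[? ?].
by move=> /andP[? ?] /andP[? ?]; split; apply/andP; split; lra.
Qed.

Lemma cnt_flatten S (T : eqType) (s : seq T) (f : T -> seq G) a :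
  a \in s -> cnt S (f a) <= cnt S (flatten (map f s)).
Proof.
elim: s => // b s IH; rewrite inE /= cnt_cat => /predU1P[->|/IH ab].
  exact: leq_addr.
by rewrite (leq_trans ab) ?leq_addl.
Qed.

Lemma passes_tr dl l H x h c : passes dl l H x -> h \in H -> {subset c <= H} ->
  (size c <= l)%N ->
  (`| tr h (cap A c) # x - cap A c # x | <= dl * x.size)%R /\
  (`| tr h (capA A c) # x - capA A c # x | <= dl * x.size)%R.
Proof.
move=> p hH cH cl; rewrite -cap_tr -capA_tr; apply: p => //.
by rewrite mem_words cl; apply/allP.
Qed.

(** The errors of the steps of a walk add up. *)
Lemma drift E E0 x (e : R) v vs :
  path (fun u w => (tr u E `\` tr w E) # x <= e)%R v vs ->
  ((E0 `\` tr (last v vs) E) # x <=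
    (E0 `\` tr v E) # x + (size vs)%:R * e)%R.
Proof.
elim: vs v => [|w vs IH] v /=; first by rewrite mul0r addr0.
move=> /andP[vw /IH /le_trans]; apply.
rewrite -[(size vs).+1]add1n natrD mulrDl mul1r addrA lerD2r.
apply: (le_trans _ (lerD (lexx _) vw)); rewrite -natrD ler_nat.
apply: (leq_trans _ (cntU _ _ _)); apply: cnt_le => y [E0y nw].
by have [vy|nvy] := pselect (tr v E y); [right|left].
Qed.

Fixpoint prefixes v (ps : seq (G * G)) : seq G :=
  if ps is p :: ps' then
    [:: v * p.1^-1, v * p.1^-1 * p.2 & prefixes (v * p.1^-1 * p.2) ps']
  else [::].

Definition pair_prod (ps : seq (G * G)) : G :=
  foldr (fun p w => p.1^-1 * p.2 * w) 1 ps.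

Definition letters (ps : seq (G * G)) := flatten [seq [:: p.1; p.2] | p <- ps].

Lemma last_prefixes v ps : last v (prefixes v ps) = v * pair_prod ps.
Proof.
elim: ps v => [|p ps IH] v /=; first by rewrite mulg1.
by rewrite IH !mulgA.
Qed.

Lemma size_prefixes v ps : size (prefixes v ps) = (size ps).*2.
Proof. by elim: ps v => //= p ps IH v; rewrite IH. Qed.

(** Going from [u] to [u * g^-1] is going from [u * g^-1] to [u] backwards, so the
    inverse of a letter costs no more than the letter. *)
Lemma prefixes_path E x (e s : R) (F : G -> set G) v ps :
  {in v :: prefixes v ps, forall u, (tr u E # x <= s + e)%R} ->
  {in v :: prefixes v ps, forall u, {in letters ps, forall g,
    (s - e <= tr u (F g) # x)%R}} ->
  (forall g, F g `<=` E `&` tr g E) ->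
  path (fun u w => (tr u E `\` tr w E) # x <= e + e)%R v (prefixes v ps).
Proof.
move=> up lo FE; elim: ps v up lo => //= p ps IH v up lo.
have step u a b (ua : G) : (tr u E # x <= s + e)%R ->
    (s - e <= tr ua (F a) # x)%R -> tr ua (F a) `<=` tr u E `&` tr b E ->
    ((tr u E `\` tr b E) # x <= e + e)%R.
  move=> h1 h2 sub; have := cntD (tr u E) (tr b E) x.
  move=> /(congr1 (fun k => k%:R%R : R)); rewrite natrD => h3.
  have : (tr ua (F a) # x <= (tr u E `&` tr b E) # x)%R.
    by rewrite ler_nat; apply: cnt_le.
  by lra.
apply/and3P; split.
- apply: (step _ p.1 _ (v * p.1^-1)).
  + by apply: up; rewrite mem_head.
  + by apply: lo; rewrite !inE eqxx ?orbT.
  + move=> y /FE [h1 h2]; split=> //; move: h2.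
    by rewrite /tr /= invgM invgK -mulgA mulKg.
- apply: (step _ p.2 _ (v * p.1^-1)).
  + by apply: up; rewrite !inE eqxx orbT.
  + by apply: lo; rewrite !inE eqxx ?orbT.
  + by move=> y /FE [h1 h2]; split=> //; rewrite trM.
- apply: IH => u uv.
    by apply: up; move: uv; rewrite !inE => /orP[]->; rewrite ?orbT.
  move=> g gl; apply: lo; last by rewrite !inE gl !orbT.
  by move: uv; rewrite !inE => /orP[]->; rewrite ?orbT.
Qed.

(** A lower bound [s] for the measure of [capA A c] under the condition that
    [cap A c] has measure [t], which is proved by [n] translations whatever the
    length of the sequence is.  The head [1] of [c] makes [cap A c] a subset of
    [A]. *)
Definition forces dl l q (t s : R) n := forall N, (0 < N)%N -> forall c,
  size c = q -> (exists c', c = 1 :: c') -> exists2 H, size H = n &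
  forall x, size x = N -> passes dl l H x -> (t * N%:R <= cap A c # x)%R ->
  (s * N%:R <= capA A c # x)%R.

(** The elements [g] for which some almost invariant measure gives a large
    intersection of [cap A c] with its translate by [g]; the two other bounds
    make [cap A c] nearly optimal for this measure. *)
Definition quasi_stab dl l n N c (t s r : R) : set G := [set g |
  forall H, size H = n -> exists x, [/\ size x = N, passes dl l H x,
    (t * N%:R <= cap A c # x)%R, (capA A c # x <= s * N%:R)%R &
    (r * N%:R <= cap A (c ++ map (fun a => g * a)%g c) # x)%R]].

Definition prod4 : set G := [set y | exists a1 a2 a3 a4,
  [/\ A a1, A a2, A a3, A a4 & y = a1 * a2 * a3 * a4]].

Section Main.
Variables (bs : seq G) (dl : R) (l : nat).
Hypothesis AV : forall a, A a -> A a^-1.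
Hypothesis cover : forall g, exists2 b, b \in bs & A (b^-1 * g).
Local Notation k := (size bs).

Lemma bs_gt0 : (0 < k)%N.
Proof. by have [b] := cover 1; case: bs. Qed.

Lemma passes_generic H x : passes dl l H x -> (0 < l)%N -> {subset bs <= H} ->
  1 \in H -> (x.size <= k%:R * (A # x + dl * x.size))%R.
Proof.
move=> p l0 bsH H1.
have bA b : b \in bs -> (tr b A # x <= A # x + dl * x.size)%R.
  move=> bb; have [] := @passes_tr dl l H x b [:: 1] p (bsH _ bb) _ l0.
    by move=> a; rewrite inE => /eqP ->.
  by rewrite cap1 tr1 ler_norml => /andP[_ h] _; lra.
have := @cnt_cover _ _ (fun b => tr b A) bs x cover.
rewrite -(ler_nat R) => /le_trans; apply; rewrite natr_sum big_seq.
apply: (le_trans (ler_sum _ bA)).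
by rewrite -big_seq big_const_seq count_predT iter_addr_0 mulr_natl.
Qed.

(** Concatenating the witnesses of the letters of a product averages the
    measures that they stand for; all letters then move [capA A c] little
    with respect to one and the same measure. *)
Lemma quasi_stab_prod (q n1 m n N : nat) c (t t' s s' r : R) :
  forces dl l (q + q) t' s n1 -> (0 < N)%N -> (0 < m)%N -> (0 < t)%R ->
  size c = q -> (exists c', c = 1 :: c') -> (q + q <= l)%N ->
  (t' * (m.*2)%:R <= r)%R ->
  (m.*2 * n1 + m.*2.+1 + m.*2 * (q + q) + q + k + 2 <= n)%N ->
  ((m.*2)%:R * (s' - s + 2 * dl) + 2 * dl < k%:R^-1)%R ->
  forall ps, size ps = m ->
  {in letters ps, forall g, quasi_stab dl l n N c t s' r g} ->
  prod4 (pair_prod ps).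
Proof.
move=> Pj N0 m0 t0 cq [c' ec] ql t'r n_ge small ps psm lX.
pose E := capA A c; pose sh g := c ++ map (fun a => g * a) c.
have szsh g : size (sh g) = (q + q)%N by rewrite size_cat size_map cq.
have szl : size (letters ps) = m.*2.
  by rewrite /letters (@size_flatten_map _ _ _ _ 2) // psm muln2.
have M0 : (0 < m.*2 * N)%N by rewrite muln_gt0 double_gt0 m0.
have /choice[Hg HgP] : forall g, exists H, size H = n1 /\
    forall x, size x = (m.*2 * N)%N -> passes dl l H x ->
    (t' * (m.*2 * N)%:R <= cap A (sh g) # x)%R ->
    (s * (m.*2 * N)%:R <= capA A (sh g) # x)%R.
  move=> g; have [||H] := Pj _ M0 (sh g); rewrite ?szsh //.
    by exists (c' ++ map (fun a => g * a) c); rewrite /sh ec.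
  by move=> Hn HP; exists H.
have c1 : c = [::1] ++ c' by [].
have [g0 g0l] : exists g, g \in letters ps.
  by case: (letters ps) szl (esym szl) m0 => [|g ?]; [case: (m) | exists g; rewrite mem_head].
(* A translate of [A] by [d] bounds the measure of [E] from below. *)
have [d dc] : exists d, cap A c d.
  have [x [xN _ h _ _]] := lX _ g0l (nseq n 1) (size_nseq _ _).
  apply: (@cnt_ex _ _ x); rewrite -(ltr_nat R); apply: (lt_le_trans _ h).
  by rewrite mulr_gt0 ?ltr0n.
pose V := 1 :: prefixes 1 ps.
(* All the translations for which invariance is used below. *)
pose H0 := flatten (map Hg (letters ps)) ++ V ++
  flatten (map sh (letters ps)) ++ c ++ bs ++ [:: d; 1].
have H0n : (size H0 <= n)%N.
  rewrite /H0 !size_cat (@size_flatten_map _ _ _ _ n1); last by move=> g; have [] := HgP g.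
  rewrite (@size_flatten_map _ _ _ _ (q + q)%N) // szl /V /= size_prefixes psm cq.
  by lia.
have [H Hn sH] := sub_pad 1 H0n.
have sub g : g \in letters ps -> {subset Hg g <= H}.
  move=> gl a aH; apply: sH; rewrite /H0 mem_cat; apply/orP; left.
  by apply/flattenP; exists (Hg g) => //; apply: map_f.
have subV : {subset V <= H} by move=> a aV; apply: sH; rewrite !mem_cat aV !orbT.
have subsh g : g \in letters ps -> {subset sh g <= H}.
  move=> gl a aH; apply: sH; rewrite /H0 !mem_cat.
  have -> : a \in flatten (map sh (letters ps)).
    by apply/flattenP; exists (sh g) => //; apply: map_f.
  by rewrite !orbT.
have subc : {subset c <= H} by move=> a aV; apply: sH; rewrite !mem_cat aV !orbT.
have subb : {subset bs <= H} by move=> a aV; apply: sH; rewrite !mem_cat aV !orbT.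
have dH : d \in H by apply: sH; rewrite !mem_cat !inE eqxx !orbT.
have oneH : 1 \in H by apply: sH; rewrite !mem_cat !inE eqxx !orbT.
have /choice[xg xgP] : forall g, exists x, g \in letters ps ->
    [/\ size x = N, passes dl l H x,
      (capA A c # x <= s' * N%:R)%R & (r * N%:R <= cap A (sh g) # x)%R].
  move=> g; have [gl|] := boolP (g \in letters ps); last by exists [::].
  by have [x [? ? ? ? ?]] := lX _ gl H Hn; exists x.
pose x := flatten (map xg (letters ps)).
have px : passes dl l H x.
  by apply: passes_flatten => g gl; have [] := xgP g gl.
have [szx upE] : size x = (m.*2 * N)%N /\ (E # x <= s' * (m.*2 * N)%:R)%R.
  rewrite -szl /x; move: (letters ps) xgP => ls; elim: ls => [|g ls IH] xgP'.
    by rewrite /= mul0n mulr0.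
  have [h1 _ h2 _] := xgP' g (mem_head _ _).
  have [|i1 i2] := IH; first by move=> a al; apply: xgP'; rewrite inE al orbT.
  rewrite /= size_cat h1 i1 mulSn; split=> //.
  by rewrite cnt_cat !natrD mulrDr lerD.
have lo g : g \in letters ps -> (s * x.size <= capA A (sh g) # x)%R.
  move=> gl; rewrite szx; have [_] := HgP g; apply=> //.
    by apply: passes_sub px; apply: sub.
  have [h1 _ _ h2] := xgP g gl.
  have := @cnt_flatten (cap A (sh g)) _ _ xg g gl.
  rewrite -(ler_nat R) -/x => /(le_trans h2); apply: le_trans.
  by rewrite natrM mulrA ler_wpM2r.
have cl : (size c <= l)%N by rewrite cq (leq_trans _ ql) // leq_addr.
(* Translates of [E] have measure at most [s'], and [E] shares with its
   translate by a letter a set of measure at least [s]. *)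
have path1 : path (fun u w => (tr u E `\` tr w E) # x <=
    ((s' - s) / 2 + dl) * x.size + ((s' - s) / 2 + dl) * x.size)%R 1 (prefixes 1 ps).
  apply: (@prefixes_path _ x _ ((s' + s) / 2 * x.size)%R
    (fun g => capA A (sh g))) => [u uV|u uV g gl|g].
  - have [_] := passes_tr px (subV _ uV) subc cl.
    rewrite ler_norml -/E => /andP[_ h]; rewrite -szx in upE; lra.
  - have [] := passes_tr px (subV _ uV) (subsh _ gl) _.
      by rewrite szsh.
    move=> _; rewrite ler_norml => /andP[h _]; have := lo g gl; lra.
  - move=> y; rewrite /E /sh => h; split.
      by apply: capA_sub h; rewrite cap_cat => z [].
    by rewrite -capA_tr; apply: capA_sub h; rewrite cap_cat => z [].
have x0 : (0 < x.size)%R by rewrite szx ltr0n.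
(* The product moves less than the measure of [E], so some point remains. *)
have dr : ((E `\` tr (pair_prod ps) E) # x <=
    (m.*2)%:R * ((s' - s) + 2 * dl) * x.size)%R.
  have := drift E path1; rewrite last_prefixes mul1g tr1 size_prefixes psm.
  have -> : E `\` E = set0 by rewrite setDv.
  by rewrite cnt_set0; lra.
have big : (k%:R^-1 * x.size - 2 * dl * x.size <= E # x)%R.
  have l0 : (0 < l)%N by apply: leq_trans cl; rewrite ec.
  have := passes_generic px l0 subb oneH.
  have k0 : (0 < k%:R :> R)%R by rewrite ltr0n bs_gt0.
  rewrite mulrC -ler_pdivrMr // mulrC => hA.
  have [] := @passes_tr dl l H x d [:: 1] px dH _ l0.
    by move=> a; rewrite inE => /eqP ->.
  rewrite cap1 tr1 ler_norml => /andP[h _] _.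
  have : (tr d A # x <= E # x)%R by rewrite ler_nat; apply: cnt_le => y; exists d.
  lra.
have : (0 < (E `&` tr (pair_prod ps) E) # x)%R.
  have := cntD E (tr (pair_prod ps) E) x.
  move=> /(congr1 (fun k => k%:R%R : R)); rewrite natrD => h3.
  have := ltr_pM2r x0 ((m.*2)%:R * (s' - s + 2 * dl) + 2 * dl)%R (k%:R^-1)%R.
  rewrite small => h4; lra.
rewrite ltr0n => /cnt_ex[y [[a [ac Aa]] [b [bc Ab]]]].
have cA z : cap A c z -> A z.
  by rewrite ec /= invg1 mul1g => -[].
exists a, (a^-1 * y), (b^-1 * ((pair_prod ps)^-1 * y))^-1, b^-1.
split; [exact: cA|by []|exact: AV|by apply: AV; apply: cA|].
by rewrite mulVKg !invgM !invgK !mulgA mulgK mulgV mul1g.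
Qed.

End Main.

End Almost.

Section Generic.
Variables (R : realType) (G : groupType) (A : set G).
Implicit Types (c H x : seq G) (g h u v w y : G) (S E : set G).
Local Open Scope group_scope.

Local Notation "S # x" := ((cnt S x)%:R%R : R) (at level 20).
Local Notation "x '.size'" := ((size x)%:R%R : R) (at level 2).

Definition left_generic S :=
  exists gs : seq G, forall g, exists2 h, h \in gs & S (h^-1 * g).

(** Each term is chosen outside the translates of [S] by the previous ones. *)
Lemma not_left_generic S : ~ left_generic S ->
  exists F : nat -> G, forall i j, (i < j)%N -> ~ S ((F i)^-1 * F j).
Proof.
move=> nS; have /choice[nx nxP] : forall gs, exists g,
    forall h, h \in (gs : seq G) -> ~ S (h^-1 * g).
  move=> gs; apply: contra_notP nS => nx; exists gs => g.
  apply: contra_notP nx => ng; exists g => h hgs Sh; apply: ng.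
  by exists h.
pose fix L n := if n is n'.+1 then nx (L n') :: L n' else [::].
exists (fun n => nx (L n)) => i j; elim: j => // j IH ij.
apply: nxP; move: ij; rewrite ltnS; elim: j {IH} => [|j IH].
  by rewrite leqn0 => /eqP ->; rewrite mem_head.
rewrite leq_eqVlt => /predU1P[->|/IH ij]; first exact: mem_head.
by rewrite inE ij orbT.
Qed.

(** The pigeonhole argument: a sequence of elements none of whose quotients
    lies in the set would be refuted by finitely many tests, and one almost
    invariant measure that passes all of them gives too many almost disjoint
    translates of [cap A c]. *)
Lemma quasi_stab_generic (dl : R) l q n n2 p (t s r : R) :
  (0 <= dl)%R -> (0 <= r)%R ->
  ~ forces A dl l q t s n2 -> (q + q <= l)%N ->
  (2 < p%:R * (t - dl))%R -> (p%:R * (p%:R * (r + dl)) <= 1)%R ->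
  (p * p * n + p + p * p * (q + q) + q <= n2)%N ->
  exists N c, [/\ (0 < N)%N, size c = q, exists c', c = 1 :: c' &
    left_generic (quasi_stab A dl l n N c t s r)].
Proof.
move=> dl0 r0 nP ql tp rp n2_ge.
have {nP}[N [c [N0 cq c1 NcP]]] : exists N c, [/\ (0 < N)%N, size c = q,
    exists c', c = 1 :: c' & forall H, size H = n2 -> exists x,
    [/\ size x = N, passes A dl l H x, (t * N%:R <= cap A c # x)%R &
      (capA A c # x < s * N%:R)%R]].
  apply: contra_notP nP => nN N N0 c cq c1; apply: contra_notP nN => nH.
  exists N, c; split=> // H Hn; apply: contra_notP nH => nx.
  exists H => // x xN px tx; rewrite leNgt; apply/negP => xs.
  by apply: nx; exists x.
exists N, c; split=> //; apply: contrapT => /not_left_generic[F FP].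
pose sh i j := c ++ map (fun a => (F i)^-1 * F j * a) c.
have /choice[Hf HfP] : forall ij : nat * nat, exists H, size H = n /\
    ((ij.1 < ij.2)%N -> forall x, size x = N -> passes A dl l H x ->
    (t * N%:R <= cap A c # x)%R -> (capA A c # x < s * N%:R)%R ->
    (cap A (sh ij.1 ij.2) # x <= r * N%:R)%R).
  move=> [i j]; have [ij|] := boolP (i < j)%N; last first.
    by move=> _; exists (nseq n 1); rewrite size_nseq.
  apply: contra_notP (FP i j ij) => nH H Hn; apply: contra_notP nH => nx.
  exists H; split=> // _ x xN px tx sx; rewrite leNgt; apply/negP => rx.
  by apply: nx; exists x; split=> //; apply: ltW.
pose ps := [seq (i, j) | i <- iota 0 p, j <- iota 0 p].
have szps : size ps = (p * p)%N by rewrite size_allpairs size_iota.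
have szsh ij : size (sh ij.1 ij.2) = (q + q)%N by rewrite size_cat size_map cq.
pose H0 := flatten (map Hf ps) ++ map F (iota 0 p) ++
  flatten (map (fun ij => sh ij.1 ij.2) ps) ++ c.
have H0n : (size H0 <= n2)%N.
  rewrite /H0 !size_cat (@size_flatten_map _ _ _ _ n); last by move=> g; have [] := HfP g.
  rewrite (@size_flatten_map _ _ _ _ (q + q)%N) // szps size_map size_iota cq.
  by lia.
have [H Hn sH] := sub_pad 1 H0n.
have [x [xN px tx sx]] := NcP H Hn.
have psP i j : (i < j)%N -> (j < p)%N -> (i, j) \in ps.
  move=> ij jp; apply/allpairsP; exists (i, j); rewrite !mem_iota /= !add0n.
  by rewrite jp (ltn_trans ij jp).
have FH i : (i < p)%N -> F i \in H.
  move=> ip; apply: sH; rewrite /H0 !mem_cat.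
  by rewrite (map_f F (_ : i \in iota 0 p)) ?orbT // mem_iota.
have cH : {subset c <= H} by move=> a aV; apply: sH; rewrite !mem_cat aV !orbT.
have subHf ij : ij \in ps -> {subset Hf ij <= H}.
  move=> gl a aH; apply: sH; rewrite /H0 mem_cat; apply/orP; left.
  by apply/flattenP; exists (Hf ij) => //; apply: map_f.
have subsh ij : ij \in ps -> {subset sh ij.1 ij.2 <= H}.
  move=> gl a aH; apply: sH; rewrite /H0 !mem_cat.
  have -> : a \in flatten (map (fun ij => sh ij.1 ij.2) ps).
    by apply/flattenP; exists (sh ij.1 ij.2) => //; apply: (map_f (fun ij => sh ij.1 ij.2)).
  by rewrite !orbT.
have x0 : (0 < N%:R :> R)%R by rewrite ltr0n.
have lo (i : 'I_p) : ((t - dl) * N%:R <= tr (F i) (cap A c) # x)%R.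
  have [] := passes_tr px (FH i (ltn_ord i)) cH _; first by rewrite cq; lia.
  by rewrite xN ler_norml => /andP[h _] _; lra.
have up i j : (i < j)%N -> (j < p)%N ->
    ((tr (F i) (cap A c) `&` tr (F j) (cap A c)) # x <= (r + dl) * N%:R)%R.
  move=> ij jp; have pij := psP _ _ ij jp.
  have -> : tr (F i) (cap A c) `&` tr (F j) (cap A c) =
      tr (F i) (cap A (sh i j)).
    rewrite cap_cat cap_tr -{1}(mulVKg (F i) (F j)) trM.
    by apply/seteqP; split=> y.
  have [] := passes_tr px (FH i (ltn_trans ij jp)) (subsh _ pij) _.
    by rewrite szsh.
  rewrite xN ler_norml => /andP[_ h] _.
  have [_ /(_ ij x xN)] := HfP (i, j).
  move=> /(_ (passes_sub (subHf _ pij) px) tx sx) /=; lra.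
have := @cnt_pairs _ p (fun i => tr (F i) (cap A c)) x.
rewrite xN -(ler_nat R) natrD natr_sum natr_sum.
have h1 : (p%:R * ((t - dl) * N%:R) <= \sum_(i < p) tr (F i) (cap A c) # x)%R.
  apply: (le_trans _ (ler_sum _ (fun i _ => lo i))).
  by rewrite sumr_const card_ord mulr_natl.
have h2 : (\sum_(j < p) (\sum_(i < j)
    cnt (tr (F i) (cap A c) `&` tr (F j) (cap A c)) x)%:R <=
    p%:R * (p%:R * ((r + dl) * N%:R)) :> R)%R.
  rewrite [leRHS]mulr_natl -[X in (_ *+ X)%R](card_ord p) -sumr_const.
  apply: ler_sum => j _; rewrite natr_sum.
  apply: (@le_trans _ _ (\sum_(i < j) (r + dl) * N%:R)%R).
    by apply: ler_sum => i _; apply: up.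
  rewrite sumr_const card_ord -[leLHS]mulr_natl ler_wpM2r ?ler_nat ?(ltnW (ltn_ord j)) //.
  by rewrite mulr_ge0 ?addr_ge0 // ltW.
have h3 : (2 * N%:R < p%:R * (t - dl) * N%:R)%R by rewrite ltr_pM2r.
have h4 : (p%:R * (p%:R * (r + dl)) * N%:R <= 1 * N%:R)%R by rewrite ler_pM2r.
by lra.
Qed.

End Generic.

Section Stages.
Variables (R : realType) (M : nat) (t0 : R).
Hypotheses (M0 : (0 < M)%N) (t00 : (0 < t0)%R).
Local Open Scope ring_scope.

(** Among [p] translates of a set of measure [t], where [p * t] exceeds [4], two
    meet in measure [1 / p ^+ 2]; half of this is given up for the error of almost
    invariance, and the rest is divided by the number [M] of letters. *)
Definition pigeons (t : R) : nat := Num.bound (4 / t).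
Definition overlap (t : R) : R := (2 * (pigeons t)%:R ^+ 2)^-1.
Fixpoint threshold j : R :=
  if j is j'.+1 then overlap (threshold j') / M%:R else t0.

Lemma pigeonsP t : 0 < t -> 4 < (pigeons t)%:R * t.
Proof.
move=> t_gt0; rewrite -ltr_pdivrMr //; apply: archi_boundP.
by rewrite divr_ge0 // ltW.
Qed.

Lemma pigeons_gt0 t : 0 < t -> 1 <= (pigeons t)%:R :> R.
Proof.
move=> t_gt0; rewrite ler1n lt0n; apply/eqP => p0.
by have := pigeonsP t_gt0; rewrite p0; lra.
Qed.

Lemma overlap_gt0 t : 0 < t -> 0 < overlap t.
Proof.
move=> /pigeons_gt0 p; rewrite /overlap invr_gt0 mulr_gt0 // exprn_gt0 //;
  exact: lt_le_trans p.
Qed.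

Lemma overlapE t : 0 < t ->
  (pigeons t)%:R * ((pigeons t)%:R * (overlap t + overlap t)) = 1.
Proof.
move=> /pigeons_gt0 p; rewrite /overlap; field.
by apply/eqP => p0; move: p; rewrite p0; lra.
Qed.

Lemma overlap_le t : 0 < t -> overlap t <= t / 2.
Proof.
move=> t_gt0; have p := pigeons_gt0 t_gt0; have := pigeonsP t_gt0.
have := overlapE t_gt0; have := overlap_gt0 t_gt0.
set o := overlap t; set q := (pigeons t)%:R in p *; move=> o0 e h.
by rewrite leNgt; apply/negP => lt; nra.
Qed.

Lemma threshold_gt0 j : 0 < threshold j.
Proof.
by elim: j => //= j IH; rewrite divr_gt0 ?overlap_gt0 // ltr0n.
Qed.

Lemma thresholdS j : threshold j.+1 <= overlap (threshold j).
Proof.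
have o0 := overlap_gt0 (threshold_gt0 j).
by rewrite /= ler_pdivrMr ?ltr0n // ler_peMr ?ler1n // ltW.
Qed.

Lemma threshold_le i j : (i <= j)%N -> threshold j <= threshold i.
Proof.
elim: j => [|j IH]; first by rewrite leqn0 => /eqP ->.
rewrite leq_eqVlt => /predU1P[->//|/IH]; apply: le_trans.
apply: (le_trans (thresholdS j)); apply: (le_trans (overlap_le (threshold_gt0 j))).
by have := threshold_gt0 j; lra.
Qed.

End Stages.

Section Exists.
Variables (R : realType) (G : groupType) (A : set G) (bs : seq G).
Hypothesis AV : forall a, A a -> A (a^-1)%g.
Hypothesis cover : forall g, exists2 b, b \in bs & A (b^-1 * g)%g.
Hypothesis sampling : forall (dl : R) l n, (0 < dl)%R -> exists2 N, (0 < N)%N &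
  forall H : seq G, size H = n -> exists2 x, size x = N & passes A dl l H x.

(** A bound above [1] cannot be forced: [A] itself, as the intersection of copies
    of [A], has measure at least the threshold for every almost invariant
    sequence. *)
Lemma not_forces (dl : R) l j n (t s : R) :
  (0 < dl)%R -> (0 < l)%N -> (t + dl <= (size bs)%:R^-1)%R -> (1 < s)%R ->
  ~ forces A dl l (2 ^ j) t s n.
Proof.
move=> dl0 l0 t_le s1 P.
have [N N0 NP] := sampling l (n + size bs + 1) dl0.
have [||H Hn HP] := P N N0 (nseq (2 ^ j) 1%g); first by rewrite size_nseq.
  by rewrite -(prednK (expn_gt0 2 j)); eexists.
have [|x xN px] := NP (H ++ bs ++ [:: 1%g]).
  by rewrite !size_cat Hn /=; lia.
have k0 : (0 < (size bs)%:R :> R)%R by rewrite ltr0n (bs_gt0 cover).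
have := passes_generic cover px l0.
rewrite mulrC -ler_pdivrMr // mulrC xN => lo.
have := HP x xN; rewrite -(prednK (expn_gt0 2 j)) cap_nseq1 => h.
have N0' : (0 < N%:R :> R)%R by rewrite ltr0n.
have : (s * N%:R <= N%:R)%R.
  apply: (le_trans (h _ _)); last by rewrite ler_nat -[leqRHS]xN cnt_size.
    by apply: passes_sub px => a aH; rewrite !mem_cat aH.
  have := ler_wpM2r (ler0n R N) t_le; rewrite mulrDl => h1.
  have := lo _ _; rewrite mem_cat mem_cat mem_head !orbT => h2.
  have : {subset bs <= H ++ bs ++ [:: 1%g]} by move=> a ab; rewrite !mem_cat ab orbT.
  by move=> /h2 /(_ isT); lra.
by apply/negP; rewrite -ltNge -[ltLHS]mul1r ltr_pM2r.
Qed.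

(** Rounded down to multiples of [1 / J], the best lower bound that can be forced
    takes at most [J.+1] values, so it does not decrease at each of the first
    [J.+1] stages.  The number of stages depends on [m] and [size bs] only, hence
    so does the last threshold, which serves as the error [dl]. *)
Theorem exists_quasi_stab m : (0 < m)%N ->
  exists (dl : R) l n N c (t s r : R),
  left_generic (quasi_stab A dl l n N c t s r) /\
  forall ps, size ps = m ->
    {in letters ps, forall g, quasi_stab A dl l n N c t s r g} ->
    prod4 A (pair_prod ps).
Proof.
(* With this [J], the [M] letters together cost at most [M / J], an eighth of
   the lower bound [1 / k] for the measure of [capA A c]. *)
move=> m0; pose k := size bs; pose M := m.*2; pose J := (8 * M * k)%N.
have k0 : (0 < k)%N := bs_gt0 cover.
have M0 : (0 < M)%N by rewrite double_gt0.
have J0 : (0 < J)%N by rewrite !muln_gt0 M0.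
pose t0 : R := (J%:R)^-1%R.
have t00 : (0 < t0)%R by rewrite invr_gt0 ltr0n.
pose t := threshold M t0; pose dl := t J.+2; pose l := (2 ^ J.+3)%N.
have tgt j : (0 < t j)%R := threshold_gt0 M0 t00 j.
have tle i j : (i <= j)%N -> (t j <= t i)%R := @threshold_le _ _ _ M0 t00 i j.
have dl0 : (0 < dl)%R := tgt _.
have l0 : (0 < l)%N by rewrite expn_gt0.
have dlt0 : (dl <= t0)%R := tle 0 J.+2 isT.
have t0M : (t0 * (8 * M%:R) = k%:R^-1)%R.
  rewrite /t0 /J !natrM; field.
  by rewrite !pnatr_eq0 -!lt0n k0 M0.
have M1 : (1 <= M%:R :> R)%R by rewrite ler1n.
(* [i / J] is a lower bound that can be forced at stage [j]. *)
pose lev j i := `[< exists n, forces A dl l (2 ^ j) (t j) (i%:R / J%:R) n >].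
have lev0 j : exists i, lev j i.
  exists 0; apply/asboolP; exists 0; move=> N N0 c _ _; exists [::] => // x _ _ _.
  by rewrite !mul0r.
have levJ j : forall i, lev j i -> (i <= J)%N.
  move=> i /asboolP[n]; rewrite leqNgt; apply: contraPN => Ji.
  apply: not_forces => //; last by rewrite ltr_pdivlMr ?ltr0n // mul1r ltr_nat.
  have := tle 0 j isT; rewrite -/k -t0M /= -/t0 => tj0.
  apply: (@le_trans _ _ (t0 + t0)%R); first exact: lerD.
  have : (0 <= t0 * (M%:R - 1))%R by rewrite mulr_ge0 ?subr_ge0 // ltW.
  by move: t00; lra.
pose sg j := ex_maxn (lev0 j) (levJ j).
have sgP j : lev j (sg j) by rewrite /sg; case: ex_maxnP.
have sgN j : ~ lev j (sg j).+1.
  by rewrite /sg; case: ex_maxnP => i _ h /h; rewrite ltnn.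
have [j jJ sgj] : exists2 j, (j <= J)%N & (sg j <= sg j.+1)%N.
  apply: contrapT => nj.
  have dec j : (j <= J.+1)%N -> (sg j + j <= J)%N.
    elim: j => [|j IH] jJ; first by rewrite addn0; apply: (levJ 0).
    have := IH (ltnW jJ); have : ~~ (sg j <= sg j.+1)%N.
      by apply/negP => h; apply: nj; exists j.
    by lia.
  by have := dec J.+1 (leqnn _); lia.
have q2 : (2 ^ j + 2 ^ j = 2 ^ j.+1)%N by rewrite expnS; lia.
have qJ : (2 ^ j + 2 ^ j <= l)%N by rewrite q2 leq_exp2l //; lia.
have dlj : (dl <= t j.+1)%R by apply: tle; lia.
have tjS := thresholdS M0 t00 j; rewrite -/t in tjS.
have otj := overlap_le (tgt j).
have /asboolP[n1 P1] := sgP j.+1.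
pose q := (2 ^ j)%N; pose p := pigeons (t j).
pose n := (M * n1 + M.+1 + M * (q + q) + q + k + 2)%N.
pose n2 := (p * p * n + p + p * p * (q + q) + q)%N.
pose s' : R := ((sg j).+1%:R / J%:R)%R.
have [|||||N [c [N0 cq c1 gen]]] := @quasi_stab_generic R G A dl l q n n2 p (t j) s'
    (overlap (t j)) (ltW dl0) (ltW (overlap_gt0 (tgt j))).
- by move=> F; apply: (sgN j); apply/asboolP; exists n2.
- by [].
- have := pigeonsP (tgt j); rewrite -/p => h.
  have : (p%:R * (t j / 2) <= p%:R * (t j - dl))%R.
    by rewrite ler_wpM2l //; move: (tgt j); lra.
  by lra.
- rewrite -[leRHS](overlapE (tgt j)) -/p !ler_wpM2l // lerD2l.
  exact: le_trans dlj tjS.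
- by [].
exists dl, l, n, N, c, (t j), s', (overlap (t j)); split=> //.
have P1' : forces A dl l (q + q) (t j.+1) ((sg j)%:R / J%:R) n1.
  rewrite q2 => N' N'0 c' c'q c'1; have [H Hn HP] := P1 N' N'0 c' c'q c'1.
  exists H => // x xN px tx; apply: le_trans (HP x xN px tx).
  by rewrite ler_wpM2r // ler_wpM2r ?invr_ge0 // ler_nat.
move=> ps psm lX; apply: (quasi_stab_prod AV cover P1' N0 m0 (tgt j) cq c1 qJ _ _ _ psm lX).
- by rewrite /t /= divfK // pnatr_eq0 -lt0n.
- by [].
- rewrite /s' -mulrBl -natrB // subSn // subnn mul1r -/t0 -/k -t0M.
  have : (M%:R * dl <= M%:R * t0)%R by rewrite ler_wpM2l.
  have : (0 <= t0 * (M%:R - 1))%R by rewrite mulr_ge0 ?subr_ge0 // ltW.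
  have : (0 < M%:R * t0)%R by rewrite mulr_gt0 // ltr0n.
  rewrite /M; lra.
Qed.

End Exists.

(** * Sampling a finitely additive measure *)

Section Sampling.
Variables (R : realType) (T : Type) (def : set (set T)) (mu : set T -> R).
Hypotheses (defT : def setT).
Hypothesis defI : forall X Y, def X -> def Y -> def (X `&` Y).
Hypothesis defD : forall X Y, def X -> def Y -> def (X `\` Y).
Hypothesis mu_ge0 : forall X, def X -> (0 <= mu X)%R.
Hypothesis muU : forall X Y, def X -> def Y -> X `&` Y = set0 ->
  mu (X `|` Y) = (mu X + mu Y)%R.
Hypothesis muT : mu setT = 1%R.
Local Open Scope ring_scope.

Lemma mu_set0 : mu set0 = 0.
Proof.
have d0 : def set0 by rewrite -(setDv setT); apply: defD.
have := muU d0 d0; rewrite set0I setU0 => /(_ erefl); lra.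
Qed.

Lemma mu_split X Y : def X -> def Y -> mu X = mu (X `&` Y) + mu (X `\` Y).
Proof.
move=> dX dY; rewrite -muU; [|exact: defI|exact: defD|].
  by congr mu; apply/seteqP; split=> y; [have [] := pselect (Y y); [left|right] | case=> -[]].
by apply/seteqP; split=> y // -[[_ Yy] [_ /(_ Yy)]].
Qed.

(** Cutting [Z] along one set of the list at a time doubles the error. *)
Lemma sample_in (Ss : seq (set T)) (N : nat) Z :
  {in Ss, forall S, def S} -> def Z ->
  exists x, [/\ cnt Z x = size x,
    (size x)%:R <= mu Z * N%:R <= (size x)%:R + (2 ^ size Ss)%:R &
    {in Ss, forall S, `|(cnt S x)%:R - mu (Z `&` S) * N%:R| <= (2 ^ size Ss)%:R}].
Proof.
elim: Ss Z => [|S Ss IH] Z dSs dZ.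
  have [[z Zz]|nZ] := pselect (exists z, Z z); last first.
    have -> : Z = set0 by apply/seteqP; split=> // z Zz; apply: nZ; exists z.
    by exists [::]; split=> //; rewrite mu_set0 mul0r lexx add0r ler01.
  have h0 : 0 <= mu Z * N%:R by rewrite mulr_ge0 ?mu_ge0.
  have /andP[h1 h2] := truncn_itv h0.
  exists (nseq (Num.truncn (mu Z * N%:R)) z); split=> //; rewrite size_nseq.
    by elim: (Num.truncn _) => // k IH; rewrite [nseq _ _]/= cnt_cons asboolT ?IH.
  by rewrite h1 /= expn0 -natr1 in h2 *; rewrite ltW.
have dS : def S by apply: dSs; rewrite mem_head.
have dSs' : {in Ss, forall S, def S} by move=> S' h; apply: dSs; rewrite inE h orbT.
have [x [xZ /andP[x1 x2] xS]] := IH (Z `&` S) dSs' (defI dZ dS).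
have [y [yZ /andP[y1 y2] yS]] := IH (Z `\` S) dSs' (defD dZ dS).
have xZ' : cnt Z x = size x.
  by apply/eqP; rewrite eqn_leq cnt_size -{1}xZ; apply: cnt_le => z [].
have yZ' : cnt Z y = size y.
  by apply/eqP; rewrite eqn_leq cnt_size -{1}yZ; apply: cnt_le => z [].
have xS' : cnt S x = size x.
  by apply/eqP; rewrite eqn_leq cnt_size -{1}xZ; apply: cnt_le => z [].
have yS' : cnt S y = 0%N.
  have := cntD setT S y; rewrite setTI cnt_setT.
  have : (cnt (Z `\` S) y <= cnt (setT `\` S) y)%N by apply: cnt_le => z [].
  by rewrite yZ; lia.
have e2 : (2 ^ (size Ss).+1)%:R = (2 ^ size Ss)%:R + (2 ^ size Ss)%:R :> R.
  by rewrite -natrD expnS mul2n addnn.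
have mZ := mu_split dZ dS.
exists (x ++ y); split.
- by rewrite cnt_cat size_cat xZ' yZ'.
- by rewrite size_cat natrD /= e2 mZ mulrDl; apply/andP; split; lra.
- move=> S'; rewrite inE cnt_cat [size (_ :: _)]/= e2 natrD => /predU1P[->|S's].
    by rewrite xS' yS' ler_norml; apply/andP; split; lra.
  have -> : mu (Z `&` S') = mu ((Z `&` S) `&` S') + mu ((Z `\` S) `&` S').
    rewrite (mu_split (defI dZ (dSs' _ S's)) dS); congr (mu _ + mu _).
      by rewrite setIAC.
    by apply/seteqP; split=> z [[? ?] ?].
  have := xS _ S's; have := yS _ S's; rewrite !ler_norml => /andP[? ?] /andP[? ?].
  by rewrite mulrDl; apply/andP; split; lra.
Qed.

(** The length of the sequence is prescribed; [z] fills up what rounding left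
    out. *)
Lemma sample (z : T) (Ss : seq (set T)) (N : nat) :
  {in Ss, forall S, def S} ->
  exists2 x, size x = N & {in Ss, forall S,
    `|(cnt S x)%:R - mu S * N%:R| <= (2 ^ (size Ss).+1)%:R}.
Proof.
move=> dSs; have [x [_]] := sample_in N dSs defT.
rewrite muT mul1r => /andP[x1 x2] xS.
have xN : (size x <= N)%N by rewrite -(ler_nat R).
exists (x ++ nseq (N - size x) z); first by rewrite size_cat size_nseq subnKC.
move=> S SSs; have := xS S SSs; rewrite setTI.
have : (cnt S (nseq (N - size x) z))%:R <= N%:R - (size x)%:R :> R.
  rewrite -natrB // ler_nat -[leqRHS](size_nseq _ z); exact: cnt_size.
have : 0 <= (cnt S (nseq (N - size x) z))%:R :> R by [].
rewrite cnt_cat natrD expnS mul2n -addnn natrD !ler_norml.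
by move=> ? ? /andP[? ?]; apply/andP; split; lra.
Qed.

End Sampling.


Section InvariantMeasure.
Variables (R : realType) (G : groupType) (def : set (set G)) (mu : set G -> R).
Variable A : set G.
Hypotheses (defT : def setT).
Hypothesis defI : forall X Y, def X -> def Y -> def (X `&` Y).
Hypothesis defD : forall X Y, def X -> def Y -> def (X `\` Y).
Hypothesis mu_ge0 : forall X, def X -> (0 <= mu X)%R.
Hypothesis muU : forall X Y, def X -> def Y -> X `&` Y = set0 ->
  mu (X `|` Y) = (mu X + mu Y)%R.
Hypothesis muT : mu setT = 1%R.
Hypothesis mu_tr : forall g X, def X -> mu (tr g X) = mu X.
Hypothesis def_cap : forall c, def (cap A c).
Hypothesis def_capA : forall c, def (capA A c).

(** The length [N] depends on the number of the sets involved only, and so not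
    on [H]. *)
Lemma invariant_sampling (dl : R) l n : (0 < dl)%R ->
  exists2 N, (0 < N)%N & forall H : seq G, size H = n ->
  exists2 x, size x = N & passes A dl l H x.
Proof.
move=> dl0; pose sets (H : seq G) :=
  [seq cap A w | w <- words H l] ++ [seq capA A w | w <- words H l] ++
  [seq cap A (map (fun a => h * a)%g w) | h <- H, w <- words H l] ++
  [seq capA A (map (fun a => h * a)%g w) | h <- H, w <- words H l].
pose Q := size (sets (nseq n 1%g)).
have szsets H : size H = n -> size (sets H) = Q.
  move=> Hn; rewrite /Q /sets !size_cat !size_map !size_allpairs.
  by rewrite (@size_words G G H (nseq n 1%g) l) ?size_nseq ?Hn.
pose N := Num.bound ((2 ^ Q.+2)%:R / dl)%R.
have NP : ((2 ^ Q.+2)%:R <= dl * N%:R)%R.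
  rewrite mulrC -ler_pdivrMr //; apply/ltW/archi_boundP.
  by rewrite divr_ge0 // ltW.
exists N.
  rewrite lt0n; apply/eqP => N0; move: NP; rewrite N0 mulr0 lern0.
  by rewrite expn_eq0.
move=> H Hn; have [|x xN xS] := @sample _ _ def mu defT defI defD mu_ge0 muU muT 1%g (sets H) N.
  move=> S; rewrite !mem_cat => /or4P[/mapP[w _ ->]|/mapP[w _ ->]|
    /allpairsP[hw [_ _ ->]]|/allpairsP[hw [_ _ ->]]] //.
exists x => // h c hH cH; rewrite szsets // in xS.
have two (F : seq G -> set G) : (forall c, def (F c)) ->
    (forall g c, F (map (fun a => g * a)%g c) = tr g (F c)) ->
    F c \in sets H -> F (map (fun a => h * a)%g c) \in sets H ->
    near_inv dl F h c x.
  move=> dF Ftr /xS h1 /xS; rewrite /near_inv Ftr mu_tr // xN => h2.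
  move: NP; rewrite expnS mul2n -addnn natrD => NP.
  by move: h1 h2; rewrite !ler_norml => /andP[? ?] /andP[? ?]; apply/andP; split; lra.
have in_tr (F : seq G -> set G) : F (map (fun a => h * a)%g c) \in
    [seq F (map (fun a => h * a)%g w) | h <- H, w <- words H l].
  by apply/allpairsP; exists (h, c).
split; apply: two => //.
- exact: cap_tr.
- by rewrite /sets !mem_cat map_f.
- by rewrite /sets !mem_cat in_tr !orbT.
- exact: capA_tr.
- by rewrite /sets !mem_cat (map_f (capA A) cH) !orbT.
- by rewrite /sets !mem_cat in_tr !orbT.
Qed.

End InvariantMeasure.

End Combinatorics.

(** * Formulas *)

Section Renaming.
Variable L : language.

Fixpoint trename (V W : Type) (f : V -> W) (t : term L V) : term L W :=
  match t with
  | Var v => Var L (f v)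
  | App s ts => App (fun k => trename f (ts k))
  end.

Fixpoint rename (V W : Type) (f : V -> W) (psi : formula L V) : formula L W :=
  match psi with
  | Eq s t => Eq (trename f s) (trename f t)
  | Rel r ts => Rel (fun k => trename f (ts k))
  | Not psi => Not (rename f psi)
  | And psi chi => And (rename f psi) (rename f chi)
  | Ex psi => Ex (rename (omap f) psi)
  end.

Variable N : structure L.

Lemma eval_rename V W (f : V -> W) (e : W -> N) t :
  eval e (trename f t) = eval (e \o f) t.
Proof.
elim: t => //= s ts IH; congr interp_fun; apply: funext => k; exact: IH.
Qed.

Lemma sat_rename V W (f : V -> W) (e : W -> N) psi :
  sat e (rename f psi) <-> sat (e \o f) psi.
Proof.
elim: psi W f e => [{}V s t|{}V r ts|{}V psi IH|{}V psi IH1 chi IH2|{}V psi IH] W f e /=.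
- by rewrite !eval_rename.
- suff -> : (fun k => eval e (trename f (ts k))) = (fun k => eval (e \o f) (ts k)).
    by [].
  by apply: funext => k; rewrite eval_rename.
- by rewrite IH.
- by rewrite IH1 IH2.
- have ext a : extend e a \o omap f = extend (e \o f) a by apply: funext; case.
  by split=> -[a]; [rewrite IH ext | rewrite -ext -IH]; exists a.
Qed.

Lemma automorphism_sat (s : N -> N) V (e : V -> N) psi : automorphism s ->
  sat e psi <-> sat (s \o e) psi.
Proof.
move=> [[s' sK s'K] sf sr].
have se W (d : W -> N) t : s (eval d t) = eval (s \o d) t.
  elim: t => //= f ts IH; rewrite sf; congr interp_fun.
  by apply: funext => k; apply: IH.
elim: psi e => [{}V t u|{}V r ts|{}V psi IH|{}V psi IH1 chi IH2|{}V psi IH] e /=.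
- by rewrite -!se; split=> [->//|/(can_inj sK)].
- rewrite sr; suff -> : (fun k => s (eval e (ts k))) =
      (fun k => eval (s \o e) (ts k)) by [].
  by apply: funext => k; rewrite se.
- by rewrite IH.
- by rewrite IH1 IH2.
- have ext a : s \o extend e a = extend (s \o e) (s a) by apply: funext; case.
  split=> -[a]; first by rewrite IH ext; exists (s a).
  by move=> h; exists (s' a); rewrite IH ext s'K.
Qed.

End Renaming.

Section Connectives.
Variables (L : language) (V : Type).

Definition top : formula L V := Ex (Eq (Var L None) (Var L None)).

Lemma sat_top (N : structure L) (e : V -> N) : sat e top.
Proof. by have [a] := carrier_inhabited N; exists a. Qed.

(** A group element is a tuple of [n] coordinates, and quantifiers bind them one
    at a time. *)
Lemma ex_tuple k (psi : formula L (V + 'I_k)) : exists chi : formula L V,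
  forall (N : structure L) (e : V -> N),
  sat e chi <-> exists f : 'I_k -> N, sat (join e f) psi.
Proof.
elim: k psi => [|k IH] psi.
  exists (rename (fun w : V + 'I_0 => match w with inl u => u
    | inr i => False_rect V (Bool.diff_false_true (ltn_ord i)) end) psi).
  move=> N e; rewrite sat_rename; set g := (X in _ \o X).
  have ext f : e \o g = join e f by apply: funext => -[u|[]].
  have [a] := carrier_inhabited N.
  split=> [|[f]]; last by rewrite (ext f).
  by rewrite (ext (fun=> a)); exists (fun=> a).
pose g (w : V + 'I_k.+1) : option (V + 'I_k) := match w with
  | inl u => Some (inl u)
  | inr i => if unlift ord0 i is Some j then Some (inr j) else None end.
have [chi chiP] := IH (Ex (rename g psi)); exists chi => N e; rewrite chiP /=.
have ext f a : extend (join e f) a \o g =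
    join e (fun i => if unlift ord0 i is Some j then f j else a).
  by apply: funext => -[u|i] //=; case: unlift.
split=> [[f [a]]|[f]].
  by rewrite sat_rename ext; eexists; eassumption.
move=> h; exists (fun j => f (lift ord0 j)), (f ord0); rewrite sat_rename ext.
suff -> : (fun i => if unlift ord0 i is Some j then f (lift ord0 j) else f ord0) = f.
  by [].
by apply: funext => i; case: unliftP => [j|] ->.
Qed.

End Connectives.

(** * Uniformly definable relations on a definable group *)

Definition vext (V G : Type) (e : V -> G) (g : G) : option V -> G :=
  fun v => if v is Some w then e w else g.

Section Codef.
Variables (L : language) (I P : Type) (N : I -> structure L).
Variables (p : forall s, P -> N s) (n : nat).
Variables (phi : formula L ('I_n + P)) (mu : formula L ('I_n + 'I_n + 'I_n + P)).
Variables (G : I -> groupType) (x : forall s, G s -> 'I_n -> N s).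
Hypothesis dg : forall s, defines_group (p s) phi mu (@x s).

Definition coords V s (e : V -> G s) : V * 'I_n -> N s :=
  fun vk => x (e vk.1) vk.2.

(** One formula defines the relation in all the structures of the family; this
    is what lets elementarity carry statements from one of them to another. *)
Definition codef V (R : forall s, (V -> G s) -> Prop) :=
  exists psi : formula L (V * 'I_n + P),
    forall s (e : V -> G s), R s e <-> sat (join (coords e) (p s)) psi.

Implicit Types V W : Type.

Lemma codef_ext V R R' : (forall s (e : V -> G s), R s e <-> R' s e) ->
  codef R -> codef R'.
Proof. by move=> RR' [psi h]; exists psi => s e; rewrite -RR'. Qed.

Lemma codef_true V : codef (fun s (e : V -> G s) => True).
Proof. by exists (top _ _) => s e; split=> // _; apply: sat_top. Qed.

Lemma codef_not V R : codef R -> codef (fun s (e : V -> G s) => ~ R s e).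
Proof. by move=> [psi h]; exists (Not psi) => s e; rewrite h. Qed.

Lemma codef_and V R R' : codef R -> codef R' ->
  codef (fun s (e : V -> G s) => R s e /\ R' s e).
Proof. by move=> [psi h] [chi k]; exists (And psi chi) => s e; rewrite h k. Qed.

Lemma codef_or V R R' : codef R -> codef R' ->
  codef (fun s (e : V -> G s) => R s e \/ R' s e).
Proof.
move=> /codef_not h /codef_not k.
apply: codef_ext (codef_not (codef_and h k)) => s e /=.
by rewrite not_andE !notE.
Qed.

Lemma codef_imp V R R' : codef R -> codef R' ->
  codef (fun s (e : V -> G s) => R s e -> R' s e).
Proof.
move=> /codef_not h k; apply: codef_ext (codef_or h k) => s e /=.
by rewrite implyE.
Qed.

Lemma codef_iff V R R' : codef R -> codef R' ->
  codef (fun s (e : V -> G s) => R s e <-> R' s e).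
Proof. by move=> h k; apply: codef_and; apply: codef_imp. Qed.

Lemma codef_cst V (Q : Prop) : codef (fun s (e : V -> G s) => Q).
Proof.
have [q|nq] := pselect Q.
  by apply: codef_ext (codef_true V).
by apply: codef_ext (codef_not (codef_true V)) => s e; split.
Qed.

Lemma codef_rename V W (f : V -> W) R : codef R ->
  codef (fun s (e : W -> G s) => R s (e \o f)).
Proof.
move=> [psi h]; pose g (w : V * 'I_n + P) : W * 'I_n + P :=
  match w with inl vk => inl (f vk.1, vk.2) | inr q => inr q end.
exists (rename g psi) => s e; rewrite h sat_rename.
by suff -> : join (coords (e \o f)) (p s) = join (coords e) (p s) \o g by []; apply: funext => -[].
Qed.

Lemma codef_ex V R : codef R ->
  codef (fun s (e : V -> G s) => exists g, R s (vext e g)).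
Proof.
move=> [psi h].
pose f1 (w : option V * 'I_n + P) : (V * 'I_n + P) + 'I_n := match w with
  | inl (Some v, k) => inl (inl (v, k)) | inl (None, k) => inr k
  | inr q => inl (inr q) end.
pose f2 (w : 'I_n + P) : (V * 'I_n + P) + 'I_n := match w with
  | inl k => inr k | inr q => inl (inr q) end.
have [chi chiP] := ex_tuple (And (rename f1 psi) (rename f2 phi)).
exists chi => s e; rewrite chiP /=.
have e1 g : join (join (coords e) (p s)) (x g) \o f1 =
    join (coords (vext e g)) (p s).
  by apply: funext => -[[[v|] k]|q].
have e2 a : join (join (coords e) (p s)) a \o f2 = join a (p s).
  by apply: funext => -[].
split=> [[g]|[a []]].
  rewrite h => hg; exists (x g); rewrite !sat_rename e1 e2; split=> //.
  have : range (@x s) (x g) by exists g.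
  by rewrite (coord_range (dg s)).
rewrite !sat_rename e2 => h1 h2.
have : [set a | sat (join a (p s)) phi] a by [].
rewrite -(coord_range (dg s)) => -[g _ ga]; exists g.
by rewrite h -e1 ga.
Qed.

Lemma codef_all V R : codef R ->
  codef (fun s (e : V -> G s) => forall g, R s (vext e g)).
Proof.
move=> /codef_not/codef_ex/codef_not; apply: codef_ext => s e.
by split=> [h g|h [g]]; [apply: contrapT => ng; apply: h; exists g | apply].
Qed.

Lemma codef_all_seq V (T : eqType) (ts : seq T)
    (R : T -> forall s, (V -> G s) -> Prop) :
  (forall t, codef (R t)) ->
  codef (fun s (e : V -> G s) => {in ts, forall t, R t s e}).
Proof.
move=> h; elim: ts => [|t ts IH].
  by apply: codef_ext (codef_true V) => s e; split.
apply: codef_ext (codef_and (h t) IH) => s e; split=> [[ht hts] u|ht].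
  by rewrite inE => /predU1P[->//|]; apply: hts.
by split=> [|u uts]; apply: ht; rewrite inE ?eqxx ?uts ?orbT.
Qed.

Lemma codef_mul V (u v w : V) :
  codef (fun s (e : V -> G s) => (e u * e v)%g = e w).
Proof.
pose f (a : 'I_n + 'I_n + 'I_n + P) : V * 'I_n + P := match a with
  | inl (inl (inl k)) => inl (u, k) | inl (inl (inr k)) => inl (v, k)
  | inl (inr k) => inl (w, k) | inr q => inr q end.
exists (rename f mu) => s e; rewrite -(coord_mul (dg s)) sat_rename.
suff -> : join (coords e) (p s) \o f =
  join (join (join (x (e u)) (x (e v))) (x (e w))) (p s) by [].
by apply: funext => -[[[]|]|].
Qed.

(** Definability of a function is definability of its graph; the variable [None]
    stands for the value. *)
Definition defterm V (w : forall s, (V -> G s) -> G s) :=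
  codef (fun s (e : option V -> G s) => e None = w s (e \o Some)).

Lemma codef_subst V R (w : forall s, (V -> G s) -> G s) :
  codef R -> defterm w -> codef (fun s (e : V -> G s) => R s (vext e (w s e))).
Proof.
move=> hR hw; apply: codef_ext (codef_ex (codef_and hw hR)) => s e.
split=> [[g [ge hg]]|h]; last by exists (w s e).
by move: hg; rewrite (ge : g = w s e).
Qed.

Lemma codef_eq V (u v : V) : codef (fun s (e : V -> G s) => e u = e v).
Proof.
apply: codef_ext (codef_ex (codef_and (codef_mul None None None)
  (codef_mul (Some u) None (Some v)))) => s e /=.
split=> [[g [gg <-]]|<-]; last by exists 1%g; rewrite !mulg1.
by rewrite (_ : g = 1%g) ?mulg1 //; apply: (mulgI g); rewrite gg mulg1.
Qed.

Lemma defterm_var V (v : V) : defterm (fun s (e : V -> G s) => e v).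
Proof. exact: codef_eq. Qed.

Lemma defterm_rename V W (f : V -> W) (w : forall s, (V -> G s) -> G s) :
  defterm w -> defterm (fun s (e : W -> G s) => w s (e \o f)).
Proof.
move=> hw; apply: codef_ext (codef_rename (omap f) hw) => s e //.
Qed.

Lemma defterm_mul V (w1 w2 : forall s, (V -> G s) -> G s) :
  defterm w1 -> defterm w2 ->
  defterm (fun s (e : V -> G s) => (w1 s e * w2 s e)%g).
Proof.
move=> h1 h2; pose V3 := option (option (option V)).
have h := codef_mul (Some None : V3) None (Some (Some None)).
have k := codef_subst h (defterm_rename (fun v => Some (Some v)) h2).
apply: codef_ext (codef_subst k (defterm_rename (fun v => Some v) h1)) => s e.
by split=> /= ->.
Qed.

Lemma defterm_inv V (w : forall s, (V -> G s) -> G s) :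
  defterm w -> defterm (fun s (e : V -> G s) => (w s e)^-1%g).
Proof.
move=> hw; pose V3 := option (option (option V)).
have h := codef_ex (codef_and
  (codef_mul (Some None : V3) (Some (Some None)) None) (codef_mul (None : V3) None None)).
apply: codef_ext (codef_subst h (defterm_rename (fun v => Some v) hw)) => s e.
split=> /= [[b [wb bb]]|->]; last by exists 1%g; rewrite mulgV mulg1.
have b1 : b = 1%g by apply: (mulgI b); rewrite bb mulg1.
by apply: (mulgI (w s (e \o Some))); rewrite mulgV [LHS]wb.
Qed.

(** The same parameters are the coordinates of [c s] in each structure of the
    family, so that one formula can refer to all the [c s]. *)
Definition parametric (c : forall s, G s) :=
  exists q : 'I_n -> P, forall s, x (c s) = p s \o q.

Lemma defterm_const V c : parametric c -> defterm (fun s (e : V -> G s) => c s).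
Proof.
move=> [q cq]; have [psi h] := codef_eq (Some None : option (option V)) None.
pose f (w : option (option V) * 'I_n + P) : option V * 'I_n + P := match w with
  | inl (Some v, k) => inl (v, k) | inl (None, k) => inr (q k)
  | inr a => inr a end.
exists (rename f psi) => s e; rewrite sat_rename.
have := h s (vext e (c s)).
suff -> : join (coords (vext e (c s))) (p s) = join (coords e) (p s) \o f by [].
by apply: funext => -[[[v|] k]|a] //=; rewrite /coords /= cq.
Qed.

Lemma defterm_one V : defterm (fun s (e : V -> G s) => 1%g).
Proof.
apply: codef_ext (codef_mul None None None) => s e.
by split=> [h|->]; [apply: (mulgI (e None)); rewrite h mulg1|rewrite mulg1].
Qed.

Lemma defterm_prod V (T : Type) (ts : seq T) (w : T -> forall s, (V -> G s) -> G s) :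
  (forall t, defterm (w t)) ->
  defterm (fun s (e : V -> G s) => foldr (fun t g => w t s e * g)%g 1%g ts).
Proof.
move=> h; elim: ts => [|t ts IH] /=; first exact: defterm_one.
exact: defterm_mul.
Qed.

Definition dset (A : forall s, set (G s)) :=
  codef (fun s (e : unit -> G s) => A s (e tt)).

Lemma codef_in V A (w : forall s, (V -> G s) -> G s) :
  dset A -> defterm w -> codef (fun s (e : V -> G s) => A s (w s e)).
Proof.
move=> hA hw.
exact: codef_subst (codef_rename (fun=> None : option V) hA) hw.
Qed.

Definition vjoin V W H (e : V -> H) (f : W -> H) : V + W -> H :=
  fun v => match v with inl u => e u | inr w => f w end.

Lemma codef_ex_fun V k R : codef R ->
  codef (fun s (e : V -> G s) => exists f : 'I_k -> G s, R s (vjoin e f)).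
Proof.
elim: k R => [|k IH] R hR.
  pose g (w : V + 'I_0) : V := match w with inl u => u
    | inr i => False_rect V (Bool.diff_false_true (ltn_ord i)) end.
  apply: codef_ext (codef_rename g hR) => s e.
  have ext f : e \o g = vjoin e f by apply: funext => -[u|[]].
  by split=> [h|[f]]; [exists (fun=> 1%g); rewrite -ext | rewrite (ext f)].
pose g (w : V + 'I_k.+1) : option (V + 'I_k) := match w with
  | inl u => Some (inl u)
  | inr i => if unlift ord0 i is Some j then Some (inr j) else None end.
apply: codef_ext (IH _ (codef_ex (codef_rename g hR))) => s e.
have ext f a : vext (vjoin e f) a \o g =
    vjoin e (fun i => if unlift ord0 i is Some j then f j else a).
  by apply: funext => -[u|i] //=; case: unlift.
split=> [[f [a]]|[f]]; first by rewrite ext; eexists; eassumption.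
move=> h; exists (fun j => f (lift ord0 j)), (f ord0); rewrite ext.
suff -> : (fun i => if unlift ord0 i is Some j then f (lift ord0 j) else f ord0) = f.
  by [].
by apply: funext => i; case: unliftP => [j|] ->.
Qed.

Lemma codef_all_fun V k R : codef R ->
  codef (fun s (e : V -> G s) => forall f : 'I_k -> G s, R s (vjoin e f)).
Proof.
move=> /codef_not/codef_ex_fun/codef_not; apply: codef_ext => s e.
by split=> [h g|h [g]]; [apply: contrapT => ng; apply: h; exists g | apply].
Qed.

(** A statement about a number of points is a finite disjunction over their
    possible membership patterns. *)
Lemma codef_count V (T : Type) (ts : seq T) (Q : T -> forall s, (V -> G s) -> Prop)
    (R : nat -> forall s, (V -> G s) -> Prop) :
  (forall t, codef (Q t)) -> (forall k, codef (R k)) ->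
  codef (fun s (e : V -> G s) => R (count (fun t => `[< Q t s e >]) ts) s e).
Proof.
move=> hQ; elim: ts R => [|t ts IH] R hR; first exact: hR.
apply: codef_ext (codef_or (codef_and (hQ t) (IH (fun k => R k.+1) (fun k => hR k.+1)))
  (codef_and (codef_not (hQ t)) (IH R hR))) => s e /=.
case: asboolP => h; rewrite ?add1n ?add0n.
  by split=> [[[]|[]]|] //; left.
by split=> [[[]|[]]|] //; right.
Qed.

Lemma codef_cap V A (us : seq (forall s, (V -> G s) -> G s)) w :
  dset A -> (forall u, List.In u us -> defterm u) -> defterm w ->
  codef (fun s (e : V -> G s) => cap (A s) [seq u s e | u <- us] (w s e)).
Proof.
move=> hA + hw; elim: us => [|u us IH] h /=; first exact: codef_true.
apply: codef_and; last by apply: IH => v vus; apply: h; right.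
apply: codef_in => //; apply: defterm_mul => //; apply: defterm_inv.
by apply: h; left.
Qed.

Lemma codef_capA V A (us : seq (forall s, (V -> G s) -> G s)) w :
  dset A -> (forall u, List.In u us -> defterm u) -> defterm w ->
  codef (fun s (e : V -> G s) => capA (A s) [seq u s e | u <- us] (w s e)).
Proof.
move=> hA h hw.
pose lift (u : forall s, (V -> G s) -> G s) s (e : option V -> G s) :=
  u s (e \o Some).
pose us' := map lift us.
have hus' u : List.In u us' -> defterm u.
  move=> /List.in_map_iff[v [<- /h]]; exact: defterm_rename.
have k1 := codef_cap hA hus' (defterm_var None).
have k2 := codef_in hA (defterm_mul (defterm_inv (defterm_var (None : option V)))
  (defterm_rename Some hw)).
apply: codef_ext (codef_ex (codef_and k1 k2)) => s e.
have us'E d : [seq u s (vext e d) | u <- us'] = [seq u s e | u <- us].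
  by rewrite -map_comp.
by split=> -[d [h1 h2]]; exists d; split=> //; move: h1; rewrite us'E.
Qed.

Lemma codef_near_inv (R : realType) V (T : Type) A (ts : seq T) (dl : R)
    (xt : T -> forall s, (V -> G s) -> G s)
    h us : dset A -> defterm h -> (forall u, List.In u us -> defterm u) ->
  (forall t, defterm (xt t)) ->
  codef (fun s (e : V -> G s) => near_inv dl (cap (A s)) (h s e)
    [seq u s e | u <- us] [seq xt t s e | t <- ts]) /\
  codef (fun s (e : V -> G s) => near_inv dl (capA (A s)) (h s e)
    [seq u s e | u <- us] [seq xt t s e | t <- ts]).
Proof.
move=> hA hh hus hx; pose hu (u : forall s, (V -> G s) -> G s) s e := (h s e * u s e)%g.
have hus' u : List.In u (map hu us) -> defterm u.
  by move=> /List.in_map_iff[v [<- /hus]]; apply: defterm_mul.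
split.
- apply: codef_ext (codef_count ts (fun t => codef_cap hA hus' (hx t))
    (fun i => codef_count ts (fun t => codef_cap hA hus (hx t))
    (fun j => codef_cst V (`|i%:R - j%:R| <= dl * (size ts)%:R)%R))) => s e.
  by rewrite /near_inv /cnt !count_map size_map -!map_comp.
- apply: codef_ext (codef_count ts (fun t => codef_capA hA hus' (hx t))
    (fun i => codef_count ts (fun t => codef_capA hA hus (hx t))
    (fun j => codef_cst V (`|i%:R - j%:R| <= dl * (size ts)%:R)%R))) => s e.
  by rewrite /near_inv /cnt !count_map size_map -!map_comp.
Qed.

(** The elements of [H] and [x] become quantified tuples and those of [c]
    parameters; the rest is a condition on finitely many membership bits. *)
Lemma dset_quasi_stab (R : realType) A (dl : R) l m k (t s r : R)
    (C : Type) (kap : C -> forall i, G i) (cs : seq C) :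
  dset A -> (forall c, parametric (kap c)) ->
  dset (fun i => quasi_stab (A i) dl l m k [seq kap c i | c <- cs] t s r).
Proof.
move=> hA hk; pose V := (unit + 'I_m + 'I_k)%type.
pose g i (e : V -> G i) := e (inl (inl tt)).
pose H (a : 'I_m) i (e : V -> G i) := e (inl (inr a)).
pose xt (b : 'I_k) i (e : V -> G i) := e (inr b).
have hH a : defterm (H a) := defterm_var _.
have hx b : defterm (xt b) := defterm_var _.
pose kc c i (e : V -> G i) := kap c i.
have hkc u : List.In u (map kc cs) -> defterm u.
  by move=> /List.in_map_iff[v [<- _]]; apply: defterm_const.
have hgkc u : List.In u (map kc cs ++ map (fun c i e => g i e * kc c i e)%g cs) ->
    defterm u.
  move=> /List.in_app_iff[/hkc//|/List.in_map_iff[v [<- _]]].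
  by apply: defterm_mul; [apply: defterm_var|apply: defterm_const].
have hwH w u : List.In u (map H w) -> defterm u.
  by move=> /List.in_map_iff[v [<- _]].
pose enumH := enum 'I_m; pose enumx := enum 'I_k.
have hnear a w := codef_near_inv enumx dl hA (hH a) (hwH w) hx.
have := codef_count enumx (fun b => codef_cap hA hkc (hx b)) (fun j =>
  codef_cst V (t * k%:R <= j%:R)%R).
have := codef_count enumx (fun b => codef_capA hA hkc (hx b)) (fun j =>
  codef_cst V (j%:R <= s * k%:R)%R).
have := codef_count enumx (fun b => codef_cap hA hgkc (hx b)) (fun j =>
  codef_cst V (r * k%:R <= j%:R)%R).
move=> h3 h2 h1.
have h0 : codef (fun i (e : V -> G i) => {in enumH, forall a,
    {in words enumH l, forall w,
    near_inv dl (cap (A i)) (H a i e) [seq H b i e | b <- w] [seq xt b i e | b <- enumx] /\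
    near_inv dl (capA (A i)) (H a i e) [seq H b i e | b <- w] [seq xt b i e | b <- enumx]}}).
  apply: codef_all_seq => a; apply: codef_all_seq => w.
  have [k1 k2] := hnear a w.
  apply: codef_ext (codef_and k1 k2) => i e; rewrite -map_comp //.
apply: codef_ext (codef_all_fun (codef_ex_fun
  (codef_and h0 (codef_and h1 (codef_and h2 h3))))) => i e.
clear h0 h1 h2 h3; have seqE (T : groupType) q (u : seq T) : size u = q ->
    exists f : 'I_q -> T, u = [seq f a | a <- enum 'I_q].
  move=> <-; exists (fun a => nth 1%g u a).
  by rewrite (map_comp (nth 1%g u) val) val_enum_ord map_nth_iota0 // take_size.
pose Hs (f : 'I_m -> G i) := [seq f a | a <- enumH].
pose xs (f : 'I_k -> G i) := [seq f a | a <- enumx].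
have passE f f0 : passes (A i) dl l (Hs f) (xs f0) <->
    {in enumH, forall a, {in words enumH l, forall w,
      near_inv dl (cap (A i)) (f a) [seq f b | b <- w] (xs f0) /\
      near_inv dl (capA (A i)) (f a) [seq f b | b <- w] (xs f0)}}.
  split=> [h a aH w wH|h u v /mapP[a aH ->{u}]].
    by apply: h; [exact: map_f|rewrite map_words map_f].
  by rewrite map_words => /mapP[w wH ->]; apply: h.
have cntE S f0 : count (fun b => `[< S (f0 b) >]) enumx = cnt S (xs f0).
  by rewrite /cnt /xs count_map; apply: eq_count.
have kcE f : [seq u i f | u <- map kc cs] = [seq kap c i | c <- cs].
  by rewrite -map_comp.
have gkcE (f : V -> G i) : [seq u i f |
    u <- map kc cs ++ map (fun c i e => g i e * kc c i e)%g cs] =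
    [seq kap c i | c <- cs] ++ map (fun a => f (inl (inl tt)) * a)%g [seq kap c i | c <- cs].
  by rewrite map_cat -!map_comp.
split=> [h u /seqE[f ->{u}]|h f].
  have [f0 [/(passE f f0) h1 [h2 [h3 h4]]]] := h f.
  exists (xs f0); split=> //; first by rewrite size_map size_enum_ord.
  - by rewrite -cntE -(kcE (vjoin (vjoin e f) f0)).
  - by rewrite -cntE -(kcE (vjoin (vjoin e f) f0)).
  - by rewrite -cntE -(gkcE (vjoin (vjoin e f) f0)).
have [|x' [/seqE[f0 x'E] h1 h2 h3 h4]] := h (Hs f).
  by rewrite size_map size_enum_ord.
rewrite x'E in h1 h2 h3 h4; exists f0; split; first by apply/passE.
by rewrite kcE gkcE !cntE.
Qed.

End Codef.

(** * From the model to the monster model *)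

Section Definable.
Variables (L : language) (I P : Type) (N : I -> structure L).
Variables (p : forall s, P -> N s) (n : nat).
Variables (phi : formula L ('I_n + P)) (mu : formula L ('I_n + 'I_n + 'I_n + P)).
Variables (G : I -> groupType) (x : forall s, G s -> 'I_n -> N s).
Hypothesis dg : forall s, defines_group (p s) phi mu (@x s).

Lemma dset_sat (psi : formula L ('I_n + P)) :
  dset p x (fun s => [set g | sat (join (x g) (p s)) psi]).
Proof.
pose f (w : 'I_n + P) : unit * 'I_n + P :=
  match w with inl k => inl (tt, k) | inr q => inr q end.
exists (rename f psi) => s e; rewrite sat_rename /=.
by suff -> : join (x (e tt)) (p s) = join (coords x e) (p s) \o f by []; apply: funext => -[].
Qed.

Lemma dsetE A : dset p x A -> exists psi : formula L ('I_n + P),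
  forall s g, A s g <-> sat (join (x g) (p s)) psi.
Proof.
move=> [psi h]; pose f (w : unit * 'I_n + P) : 'I_n + P :=
  match w with inl vk => inl vk.2 | inr q => inr q end.
exists (rename f psi) => s g; rewrite sat_rename (h s (fun=> g)).
suff -> : join (coords x (fun=> g)) (p s) = join (x g) (p s) \o f by [].
by apply: funext => -[[[] k]|].
Qed.

Lemma dset_definable A s : dset p x A -> definable (p s) (@x s) (A s).
Proof.
by move=> /dsetE[psi h]; exists psi; apply/seteqP; split=> g /h.
Qed.

Lemma dset_prod4 A : dset p x A -> dset p x (fun s => prod4 (A s)).
Proof.
move=> hA; pose V := option (option (option (option unit))).
pose v1 : V := None; pose v2 : V := Some None; pose v3 : V := Some (Some None).
pose v4 : V := Some (Some (Some None)).
pose w : V := Some (Some (Some (Some tt))).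
have var v : defterm p x (fun s (e : V -> G s) => e v) := defterm_var dg v.
have inA v := codef_in dg hA (var v).
have eqw := codef_subst dg (codef_eq dg (Some w) None)
  (defterm_mul dg (defterm_mul dg (defterm_mul dg (var v4) (var v3)) (var v2)) (var v1)).
apply: codef_ext (codef_ex dg (codef_ex dg (codef_ex dg (codef_ex dg
  (codef_and (inA v4) (codef_and (inA v3) (codef_and (inA v2)
    (codef_and (inA v1) eqw)))))))) => s e.
by split=> -[a [b [c [d]]]]; [move=> [? [? [? [? ?]]]]|move=> []]; exists a, b, c, d.
Qed.

Lemma definable_setI s X Y : definable (p s) (@x s) X -> definable (p s) (@x s) Y ->
  definable (p s) (@x s) (X `&` Y).
Proof. by move=> [psi ->] [chi ->]; exists (And psi chi). Qed.

Lemma definable_setD s X Y : definable (p s) (@x s) X -> definable (p s) (@x s) Y ->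
  definable (p s) (@x s) (X `\` Y).
Proof. by move=> [psi ->] [chi ->]; exists (And psi (Not chi)). Qed.

Lemma definable_setT s : definable (p s) (@x s) setT.
Proof.
exists (top _ _); apply/seteqP; split=> // g _; exact: sat_top.
Qed.

End Definable.

Lemma left_translateE (G : groupType) (g : G) X : left_translate g X = tr g X.
Proof.
apply/seteqP; split=> y; first by move=> [h Xh <-]; rewrite /tr /= mulKg.
by move=> h; exists (g^-1 * y)%g => //; rewrite mulVKg.
Qed.

Section Transfer.
Variables (R : realType) (L : language) (M C : structure L) (i : M -> C).
Variables (n : nat) (phi : formula L ('I_n + M)).
Variables (mu : formula L ('I_n + 'I_n + 'I_n + M)).
Variables (G Gstar : groupType) (x : G -> 'I_n -> M) (xstar : Gstar -> 'I_n -> C).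
Hypothesis elem : elementary_embedding i.
Hypothesis dgM : defines_group (@id M) phi mu x.
Hypothesis dgC : defines_group i phi mu xstar.

Let Nf (s : bool) : structure L := if s then M else C.
Let pf (s : bool) : M -> Nf s :=
  if s return M -> Nf s then id else i.
Let Gf (s : bool) : groupType := if s then G else Gstar.
Let xf (s : bool) : Gf s -> 'I_n -> Nf s :=
  if s return Gf s -> 'I_n -> Nf s then x else xstar.

Lemma dgf s : defines_group (pf s) phi mu (@xf s).
Proof. by case: s. Qed.

Lemma embG_ex g : exists h, xstar h = i \o x g.
Proof.
have : range x (x g) by exists g.
rewrite (coord_range dgM) /= => /elem.
have -> : (fun v => i (join (x g) id v)) = join (i \o x g) i.
  by apply: funext => -[].
move=> h; have : [set a | sat (join a i) phi] (i \o x g) by [].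
by rewrite -(coord_range dgC) => -[h' _ <-]; exists h'.
Qed.

(** The embedding of the group of [M] in its interpretation in [C]. *)
Definition embG g : Gstar := sval (cid (embG_ex g)).

Lemma embGE g : xstar (embG g) = i \o x g.
Proof. by rewrite /embG; case: cid. Qed.

Definition kap (g : G) (s : bool) : Gf s :=
  if s return Gf s then g else embG g.

Lemma kap_parametric g : parametric pf xf (kap g).
Proof. by exists (x g) => -[] //=; rewrite embGE. Qed.

(** Elementarity, for relations on the groups. *)
Lemma transfer V Q (e : V -> G) : codef pf xf Q ->
  Q true e <-> Q false (fun v => embG (e v)).
Proof.
move=> [psi h]; rewrite (h true) (h false) /= (elem _ psi).
suff -> : (fun v => i (join (coords xf (e : V -> Gf true)) (pf true) v)) =
  join (coords xf (fun v => embG (e v) : Gf false)) i by [].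
by apply: funext => -[vk|q] //=; rewrite /coords /= embGE.
Qed.

Lemma transfer0 Q : codef pf xf (fun s (e : Empty_set -> Gf s) => Q s) ->
  Q true -> Q false.
Proof.
move=> h; exact: (proj1 (transfer (fun v : Empty_set => match v with end) h)).
Qed.

Definition sametype (a b : Gstar) := forall psi : formula L ('I_n + M),
  sat (join (xstar a) i) psi <-> sat (join (xstar b) i) psi.

Lemma sametype_dset A a b : dset pf xf A -> sametype a b ->
  A false a <-> A false b.
Proof. by move=> /dsetE[psi h] ab; rewrite !(h false); apply: ab. Qed.

Variables (q : nat) (theta : nat -> formula L ('I_n + M)).

Definition agree s (a b : Gf s) := {in iota 0 q, forall j,
  sat (join (xf a) (pf s)) (theta j) <-> sat (join (xf b) (pf s)) (theta j)}.

Definition quot s : set (Gf s) :=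
  [set g | exists a b, @agree s a b /\ g = (a^-1 * b)%g].

Lemma quot1 s : @quot s 1%g.
Proof. by exists 1%g, 1%g; rewrite mulVg. Qed.

Lemma quotV s g : @quot s g -> @quot s g^-1%g.
Proof.
move=> [a [b [ab ->]]]; exists b, a; rewrite invgM invgK; split=> // j jq.
by rewrite ab.
Qed.

Lemma quot_dset : dset pf xf quot.
Proof.
pose V := option (option unit).
have h j v := codef_in dgf (dset_sat pf xf (theta j)) (defterm_var dgf (v : V)).
have ag := codef_all_seq (iota 0 q) (fun j => codef_iff (h j (Some None)) (h j None)).
have eqw := codef_subst dgf (codef_eq dgf (Some (Some (Some tt)) : option V) None)
  (defterm_mul dgf (defterm_inv dgf (defterm_var dgf (Some None : V)))
     (defterm_var dgf (None : V))).
by apply: codef_ext (codef_ex dgf (codef_ex dgf (codef_and ag eqw))) => s e.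
Qed.

(** There is one translate for each of the finitely many ways to satisfy the
    formulas [theta]. *)
Lemma quot_cover : exists bs : seq G,
  forall g, exists2 b, b \in bs & @quot true (b^-1 * g)%g.
Proof.
pose tv (g : G) : {ffun 'I_q -> bool} :=
  [ffun j : 'I_q => `[< sat (join (x g) id) (theta j) >]].
have /choice[rep repP] : forall v, exists g, (exists h, tv h = v) -> tv g = v.
  by move=> v; have [[g gv]|nv] := pselect (exists h, tv h = v); [exists g|exists 1%g].
exists [seq rep v | v <- enum {ffun 'I_q -> bool}] => g.
exists (rep (tv g)); first by rewrite map_f // mem_enum.
exists (rep (tv g)), g; split=> // j; rewrite mem_iota add0n => /= jq.
have : tv (rep (tv g)) = tv g by apply: repP; exists g.
move=> /(congr1 (fun v : {ffun _ -> bool} => v (Ordinal jq))); rewrite !ffunE /= => e.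
exact: asbool_eq_equiv.
Qed.

Hypothesis amenable : definably_amenable R x.

(** Elementarity carries a definable set [X] with the two properties of
    [exists_quasi_stab] to [Gstar].  As the translates of [X] that cover [Gstar]
    are definable over [M], elements of the same type lie in the same one. *)
Lemma sametype_prod (ps : seq (Gstar * Gstar)) :
  {in ps, forall r, sametype r.1 r.2} -> prod4 (@quot false) (pair_prod ps).
Proof.
case: ps => [_|r0 ps0].
  by exists 1%g, 1%g, 1%g, 1%g; rewrite !mulg1; split=> //; apply: quot1.
set ps := r0 :: ps0; move=> hps; pose m := size ps.
have [bs cover] := quot_cover.
have [meas [measT meas_ge0 measU meas_tr]] := amenable.
have hk := kap_parametric.
have capd (c : seq G) : definable (@id M) x (cap (@quot true) c) /\
    definable (@id M) x (capA (@quot true) c).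
  have hw : defterm pf xf (fun s (e : unit -> Gf s) => e tt) := defterm_var dgf tt.
  pose us := [seq (fun s (e : unit -> Gf s) => kap g s) | g <- c].
  have hus u : List.In u us -> defterm pf xf u.
    by move=> /List.in_map_iff[g [<- _]]; apply: (defterm_const dgf); apply: hk.
  have usE s (f : unit -> Gf s) : [seq u s f | u <- us] = [seq kap g s | g <- c].
    by rewrite -map_comp.
  have d1 : dset pf xf (fun s => cap (@quot s) [seq kap g s | g <- c]).
    by apply: codef_ext (codef_cap dgf quot_dset hus hw) => s f; rewrite usE.
  have d2 : dset pf xf (fun s => capA (@quot s) [seq kap g s | g <- c]).
    by apply: codef_ext (codef_capA dgf quot_dset hus hw) => s f; rewrite usE.
  by have := dset_definable true d1; have := dset_definable true d2; rewrite /= map_id.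
have sampling (dl : R) l k : (0 < dl)%R -> exists2 N, (0 < N)%N &
    forall H : seq G, size H = k ->
    exists2 u, size u = N & passes (@quot true) dl l H u.
  apply: (invariant_sampling (definable_setT pf xf true)
    (@definable_setI L bool M Nf pf n Gf xf true)
    (@definable_setD L bool M Nf pf n Gf xf true) meas_ge0 measU measT _
    (fun c => proj1 (capd c)) (fun c => proj2 (capd c))).
  by move=> g X dX; rewrite -left_translateE meas_tr.
have [dl [l [k [N [c [t [s [rho [[gs genM] prod]]]]]]]]] :=
  exists_quasi_stab (@quotV true) cover sampling (ltn0Sn (size ps0)).
pose X b := quasi_stab (@quot b) dl l k N [seq kap g b | g <- c] t s rho.
have XT : X true = quasi_stab (@quot true) dl l k N c t s rho.
  by rewrite /X map_id.
have dX : dset pf xf X := dset_quasi_stab dgf dl l k N t s rho c quot_dset hk.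
have kinv V h : defterm pf xf (fun s' (e : V -> Gf s') => (kap h s')^-1)%g :=
  defterm_inv dgf (defterm_const dgf V (hk h)).
have genC (g : Gstar) : exists2 h, h \in gs & X false ((embG h)^-1 * g)%g.
  pose Q s' := forall g : Gf s',
    ~ {in gs, forall h, ~ X s' ((kap h s')^-1 * g)%g}.
  have dQ : codef pf xf (fun s' (e : Empty_set -> Gf s') => Q s').
    have d0 : codef pf xf (fun s' (e : option Empty_set -> Gf s') =>
        ~ {in gs, forall h, ~ X s' ((kap h s')^-1 * e None)%g}).
      apply: codef_not; apply: codef_all_seq => h; apply: codef_not.
      exact: (codef_in dgf dX (defterm_mul dgf (kinv _ h) (defterm_var dgf None))).
    by apply: codef_ext (codef_all dgf d0).
  have QT : Q true.
    by move=> g' nX; have [h hgs] := genM g'; rewrite -XT; apply: nX.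
  apply: contrapT => nh; apply: (transfer0 dQ QT g) => h hgs Xh.
  by apply: nh; exists h.
have lettersP (T : groupType) (S : set T) (us : seq (T * T)) :
    {in us, forall r, S r.1 /\ S r.2} -> {in letters us, forall g, S g}.
  move=> h g /flattenP[_ /mapP[r rus ->]]; have [h1 h2] := h r rus.
  by rewrite !inE => /orP[]/eqP ->.
have prodC (us : seq (Gstar * Gstar)) : size us = m ->
    {in us, forall r, X false r.1 /\ X false r.2} ->
    prod4 (@quot false) (pair_prod us).
  pose Q s' := forall f1 f2 : 'I_m -> Gf s',
    {in enum 'I_m, forall a, X s' (f1 a) /\ X s' (f2 a)} ->
    prod4 (@quot s') (foldr (fun a g => (f1 a)^-1 * f2 a * g)%g 1%g (enum 'I_m)).
  have dQ : codef pf xf (fun s' (e : Empty_set -> Gf s') => Q s').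
    pose v1 a : Empty_set + 'I_m + 'I_m := inl (inr a).
    pose v2 a : Empty_set + 'I_m + 'I_m := inr a.
    have d1 : codef pf xf (fun s' (e : Empty_set + 'I_m + 'I_m -> Gf s') =>
        {in enum 'I_m, forall a, X s' (e (v1 a)) /\ X s' (e (v2 a))}).
      apply: codef_all_seq => a; apply: codef_and.
        exact: (codef_in dgf dX (defterm_var dgf (v1 a))).
      exact: (codef_in dgf dX (defterm_var dgf (v2 a))).
    have d2 : defterm pf xf (fun s' (e : Empty_set + 'I_m + 'I_m -> Gf s') =>
        foldr (fun a g => (e (v1 a))^-1 * e (v2 a) * g)%g 1%g (enum 'I_m)).
      apply: (defterm_prod dgf (enum 'I_m)
        (w := fun a s' e => (e (v1 a))^-1 * e (v2 a))%g) => a.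
      apply: (defterm_mul dgf); last exact: (defterm_var dgf (v2 a)).
      exact: (defterm_inv dgf (defterm_var dgf (v1 a))).
    have d3 := codef_imp d1 (codef_in dgf (dset_prod4 dgf quot_dset) d2).
    by apply: codef_ext (codef_all_fun dgf (codef_all_fun dgf d3)).
  have QT : Q true.
    move=> f1 f2 hf; pose vs := [seq (f1 a, f2 a) | a <- enum 'I_m].
    have := prod vs; rewrite /pair_prod /vs foldr_map; apply.
      by rewrite size_map size_enum_ord.
    by apply: lettersP => _ /mapP[a aI ->]; rewrite -XT; apply: hf.
  move=> usm hus; pose d : Gstar * Gstar := (1%g, 1%g).
  have usE : us = [seq nth d us (val a) | a <- enum 'I_m].
    rewrite (map_comp (nth d us) val) val_enum_ord map_nth_iota0 ?usm //.
    by rewrite -usm take_size.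
  rewrite usE /pair_prod foldr_map.
  apply: (transfer0 dQ QT (fun a => (nth d us a).1) (fun a => (nth d us a).2)).
  by move=> a _; apply: hus; rewrite mem_nth // usm.
have /choice[hh hhP] : forall g, exists h, h \in gs /\ X false ((embG h)^-1 * g)%g.
  by move=> g; have [h] := genC g; exists h.
pose us := [seq ((embG (hh r.1))^-1 * r.1, (embG (hh r.1))^-1 * r.2)%g | r <- ps].
have -> : pair_prod ps = pair_prod us.
  rewrite /us; elim: (ps) => //= r rs ->.
  by rewrite invgM invgK -!mulgA mulVKg.
apply: prodC; first by rewrite size_map.
move=> _ /mapP[r rps ->] /=; have [_ h1] := hhP r.1; split=> //.
have dXh : dset pf xf (fun s' => [set g | X s' ((kap (hh r.1) s')^-1 * g)%g]).
  exact: (codef_in dgf dX (defterm_mul dgf (kinv _ _) (defterm_var dgf tt))).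
exact: (proj1 (sametype_dset dXh (hps r rps))).
Qed.

End Transfer.

Local Open Scope card_scope.

(** * Cardinals below a strong limit *)

Lemma card_leTP T U : [set: T] #<= [set: U] <-> exists f : T -> U, injective f.
Proof.
split=> [/card_leP[g]|[f fI]].
  pose f (t : T) : U := val (g (SigSub (mem_set (I : [set: T] t)))).
  exists f => t t' /val_inj h.
  have := @inj _ _ _ g _ _ (in_setT _) (in_setT _) h.
  by move=> /(congr1 val).
have [g] : $|{injfun [set: T] >-> [set: U]}|.
  by apply/injfunPex; exists f => // t t' _ _ /fI.
exact: inj_card_le g.
Qed.

(** By Zorn, a maximal injective partial function is total or onto. *)
Lemma card_le_total T U : [set: T] #<= [set: U] \/ [set: U] #<= [set: T].
Proof.
pose P := [set A : set (T * U) | forall a b, A a -> A b ->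
  (a.1 = b.1 -> a = b) /\ (a.2 = b.2 -> a = b)].
have [|A [PA maxA]] := @Zorn_bigcup _ P.
  move=> F FP tot a b [X FX Xa] [Y FY Yb].
  by have [/(_ _ Xa) Ya|/(_ _ Yb) Xb] := tot _ _ FX FY;
    [apply: FP FY _ _ Ya Yb | apply: FP FX _ _ Xa Xb].
have [domT|/existsNP[t nt]] := pselect (forall t, exists u, A (t, u)).
  left; have /choice[f fA] := domT; apply/card_leTP; exists f => t t' e.
  by have [_ /(_ e) []] := PA _ _ (fA t) (fA t').
right; apply/card_leTP.
have ranU u : exists t, A (t, u).
  apply: contrapT => nu; apply: (maxA (A `|` [set (t, u)])).
    split=> [|sub]; first exact: subsetUl.
    by apply: nt; exists u; apply: sub; right.
  move=> [a1 a2] [b1 b2] [Aa|[-> ->]] [Ab|[-> ->]] //=; first exact: PA Aa Ab.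
  - split=> e; subst; first by case: nt; exists a2.
    by case: nu; exists a1.
  - split=> e; subst; first by case: nt; exists b2.
    by case: nu; exists b1.
have /choice[f fA] := ranU; exists f => u u' e.
by have [/(_ e) []] := PA _ _ (fA u) (fA u').
Qed.

Section Small.
Variable K : Type.
Hypotheses (limK : strong_limit K) (natK : card_lt [set: nat] [set: K]).

Definition small T := card_lt [set: T] [set: K].

Lemma card_le_small T U (A : set T) : A #<= [set: U] -> small U ->
  card_lt A [set: K].
Proof.
move=> AU [UK nKU]; split; first exact: card_le_trans AU UK.
by move=> KA; apply: nKU; apply: card_le_trans KA AU.
Qed.

Lemma small_inj T U (f : T -> U) : injective f -> small U -> small T.
Proof. by move=> fI; apply: card_le_small; apply/card_leTP; exists f. Qed.

Lemma small_set T : small T -> small (set T).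
Proof. exact: limK. Qed.

Lemma small_sum T U : small T -> small U -> small (T + U).
Proof.
have aux A B (f : A -> B) : injective f -> small B -> small (A + B).
  (* The value at a point of [B] is told apart by containing [set0]. *)
  move=> fI sB; pose g (w : A + B) : set (set B) := match w with
    | inl a => [set [set f a]] | inr b => [set [set b]] `|` [set set0] end.
  have ne b : [set b] <> set0 :> set B.
    by move=> /seteqP[/(_ b erefl)].
  apply: (@small_inj _ _ g); last by do 2!apply: small_set.
  move=> [a|b] [a'|b'] /= e.
  - have : [set [set f a']] [set f a] by rewrite -e.
    by move=> /= /seteqP[/(_ _ erefl)/= /fI ->].
  - have : [set [set f a]] (set0 : set B) by rewrite e; right.
    by move=> /= /esym /ne.
  - have : [set [set f a']] (set0 : set B) by rewrite -e; right.
    by move=> /= /esym /ne.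
  - have : ([set [set b']] `|` [set set0]) [set b] by rewrite -e; left.
    by move=> [/= /seteqP[/(_ _ erefl)/= ->]|/= /ne].
move=> sT sU; have [/card_leTP[f fI]|/card_leTP[f fI]] := card_le_total T U.
  exact: aux fI sU.
apply: (@small_inj _ _ (fun w : T + U => match w with inl t => inr t | inr u => inl u end)).
  by move=> [t|u] [t'|u'] // [->].
exact: aux fI sT.
Qed.

Lemma small_prod T U : small T -> small U -> small (T * U).
Proof.
move=> sT sU; apply: (@small_inj _ _ (fun w : T * U => [set inl w.1] `|` [set inr w.2])).
  move=> [t u] [t' u'] /= e.
  have : ([set inl t'] `|` [set inr u']) (inl t : T + U) by rewrite -e; left.
  have : ([set inl t'] `|` [set inr u']) (inr u : T + U) by rewrite -e; right.
  by move=> [//|[->]] [[->]|].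
by apply: small_set; apply: small_sum.
Qed.

Lemma small_fin (T : finType) : small T.
Proof.
apply: (@small_inj _ _ (fun t : T => nat_of_ord (enum_rank t))) => //.
by move=> t t' /ord_inj/enum_rank_inj.
Qed.

Lemma small_fun (T : finType) U : small U -> small (T -> U).
Proof.
move=> sU; apply: (@small_inj _ _ (fun f : T -> U => [set w : T * U | f w.1 = w.2])).
  move=> f g /seteqP[fg _]; apply: funext => t.
  by have := fg (t, f t) erefl.
by apply: small_set; apply: small_prod => //; apply: small_fin.
Qed.

(** Cantor's theorem. *)
Lemma not_injective_set T (f : set T -> T) : ~ injective f.
Proof.
move=> fI; pose D := [set t | exists2 A : set T, f A = t & ~ A t].
have [Df|nDf] := pselect (D (f D)); last by apply: (nDf); exists D.
by have [A /fI ->] := Df.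
Qed.

End Small.

(** * Saturation and homogeneity *)

Section Monster.
Variables (K : Type) (L : language) (M C : structure L) (i : M -> C).
Hypotheses (limK : strong_limit K) (largeK : sufficiently_large K M).
Hypothesis monsterC : monster K i.

Lemma small_M : small K M. Proof. by case: largeK. Qed.

Lemma range_small W (z : W -> C) : small K W -> card_lt (range z) [set: K].
Proof. by apply: card_le_small; apply: card_image_le. Qed.

Lemma homogeneous_tuple W (z z' : W -> C) : small K W ->
  (forall psi : formula L W, sat z psi <-> sat z' psi) ->
  exists s, automorphism s /\ forall w, s (z w) = z' w.
Proof.
move=> sW zz'; have [_ _ homC] := monsterC.
have /choice[pick pickP] : forall a : range z, exists w, z w = val a.
  by case=> a /= /set_mem [w _ <-]; exists w.
have [phi|s [autos sP]] := homC (range z) (z' \o pick) (range_small z sW).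
  have -> : (val : range z -> C) = z \o pick by apply: funext => a /=; rewrite pickP.
  by rewrite -(sat_rename pick z) -(sat_rename pick z'); apply: zz'.
exists s; split=> // w.
have rw : range z (z w) by exists w.
have := sP (SigSub (mem_set rw)); rewrite /= => ->.
by have := zz' (Eq (Var L (pick (SigSub (mem_set rw)))) (Var L w)); rewrite /= pickP => -[] h _; apply: h.
Qed.

Section Tuples.
Variables (n : nat) (phi : formula L ('I_n + M)) (Gstar : groupType).
Variables (xstar : Gstar -> 'I_n -> C).
Hypothesis range_x : range xstar = [set a | sat (join a i) phi].

(** Saturation provides points of [C]; adding [phi] for each of the [v] tuples of
    variables makes these points coordinates of group elements. *)
Lemma saturated_group W (z : W -> C) v T
    (psi : T -> formula L ('I_v * 'I_n + (M + W))) : small K W ->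
  (forall ts : seq T, exists e : 'I_v -> Gstar, forall t, List.In t ts ->
    sat (join (fun vk => xstar (e vk.1) vk.2) (join i z)) (psi t)) ->
  exists e : 'I_v -> Gstar, forall t,
    sat (join (fun vk => xstar (e vk.1) vk.2) (join i z)) (psi t).
Proof.
move=> sW fin; have [_ satC _] := monsterC; set jz := join i z.
pose A := range jz; have jzA w : A (jz w) by exists w.
pose pA w : A := SigSub (mem_set (jzA w)).
pose d := #|{: 'I_v * 'I_n}|.
pose g (w : 'I_v * 'I_n + (M + W)) : 'I_d + A :=
  match w with inl vk => inl (enum_rank vk) | inr a => inr (pA a) end.
pose f v0 (w : 'I_n + M) : 'I_v * 'I_n + (M + W) :=
  match w with inl k => inl (v0, k) | inr m => inr (inl m) end.
pose p : set (formula L ('I_d + A)) := [set chi |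
  (exists t, chi = rename g (psi t)) \/
  (exists v0, chi = rename g (rename (f v0) phi))].
have gE c : join c (val : A -> C) \o g = join (fun vk => c (enum_rank vk)) jz.
  by apply: funext => -[].
have fE (e : 'I_v * 'I_n -> C) v0 : join e jz \o f v0 = join (fun k => e (v0, k)) i.
  by apply: funext => -[].
have cA : card_lt A [set: K].
  by apply: range_small; apply: small_sum => //; apply: small_M.
have [q finq qp|c cP] := satC A d p cA.
  have [s qs] : exists s : seq {classic formula L ('I_d + A)}, q = [set` s].
    exact/finite_seqP.
  have [ts tsP] : exists ts : seq T, forall chi : {classic formula L ('I_d + A)},
      chi \in s -> (exists2 t, List.In t ts & chi = rename g (psi t)) \/
      (exists v0, chi = rename g (rename (f v0) phi)).
    have {qs} : forall chi, chi \in s -> p chi by move=> chi cs; apply: qp; rewrite qs.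
    elim: s => [|chi s IH] sp; first by exists [::].
    have [|ts tsP] := IH; first by move=> x xs; apply: sp; rewrite inE xs orbT.
    have [[t e]|h] := sp chi (mem_head _ _).
      exists (t :: ts) => x; rewrite inE => /predU1P[->|/tsP[[t' t's e']|h]].
      - by left; exists t => //; left.
      - by left; exists t' => //; right.
      - by right.
    by exists ts => x; rewrite inE => /predU1P[->|/tsP]; first by right.
  have [e eP] := fin ts.
  exists (fun a => let vk := enum_val a in xstar (e vk.1) vk.2) => chi.
  have eE : (fun vk => let vk := enum_val (enum_rank vk) in xstar (e vk.1) vk.2) =
      (fun vk : 'I_v * 'I_n => xstar (e vk.1) vk.2).
    by apply: funext => vk; rewrite enum_rankK.
  rewrite qs => /tsP[[t /eP h ->]|[v0 ->]].
    by rewrite sat_rename gE eE.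
  rewrite 2!sat_rename gE eE fE /=.
  have : range xstar (xstar (e v0)) by exists (e v0).
  by rewrite range_x.
have /choice[e eP] : forall v0 : 'I_v, exists h, xstar h = fun k => c (enum_rank (v0, k)).
  move=> v0; have := cP _ (or_intror (ex_intro _ v0 erefl)).
  rewrite 2!sat_rename gE fE => h.
  have : [set a | sat (join a i) phi] (fun k => c (enum_rank (v0, k))) by [].
  by rewrite -range_x => -[h' _ <-]; exists h'.
exists e => t; have := cP _ (or_introl (ex_intro _ t erefl)).
rewrite sat_rename gE; suff -> : (fun vk => c (enum_rank vk)) =
  (fun vk : 'I_v * 'I_n => xstar (e vk.1) vk.2) by [].
by apply: funext => -[v0 k]; rewrite eP.
Qed.

End Tuples.

End Monster.

(** Each term is chosen according to all the previous ones, along a well-order of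
    [I].  The hypothesis only concerns families whose index set embeds in [I],
    which bounds their cardinal. *)
Lemma wo_recursion (I T : Type) (good : forall J : Type, (J -> T) -> T -> Prop) :
  (forall (J : Type) (f : J -> I) (y : J -> T), injective f -> exists c, good J y c) ->
  exists (lt : I -> I -> Prop) (c : I -> T),
    (forall j k, j <> k -> lt j k \/ lt k j) /\
    forall k, good {j | lt j k} (fun j => c (sval j)) (c k).
Proof.
move=> ex; have [R wo] := well_ordering_principle {classic I}.
have wo' (A : pred {classic I}) a : a \in A -> exists z, minimum_of R A z.
  by move=> aA; have [|z [zm _]] := wo A; [exists a|exists z].
have tot j k : R j k \/ R k j.
  have [|z [zA zR]] := wo' (pred2 j k) j; first by rewrite inE eqxx.
  move: zA; rewrite inE => /orP[]/eqP zE; subst z.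
    by left; apply: zR; rewrite !inE eqxx orbT.
  by right; apply: zR; rewrite !inE eqxx.
pose lt j k := R j k /\ j <> k.
have anti j k : R j k -> R k j -> j = k.
  move=> jk kj; have [|z [_ uz]] := wo (pred2 j k); first by exists j; rewrite inE eqxx.
  have rr a : R a a by case: (tot a a).
  rewrite -(uz j) ?(uz k) //; split; rewrite ?inE ?eqxx ?orbT // => a.
    by rewrite inE => /orP[]/eqP ->.
  by rewrite inE => /orP[]/eqP ->.
have wf : well_founded lt.
  move=> k; apply: contrapT => nk.
  pose A : pred {classic I} := fun j => `[< ~ Acc lt j >].
  have [|z [/asboolP zA zR]] := wo' A k; first exact/asboolP.
  apply: zA; constructor => j [jz nj]; apply: contrapT => nj'.
  by apply: nj; apply: anti => //; apply: zR; apply/asboolP.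
have pick_ex : forall k : I, exists F : ({j | lt j k} -> T) -> T,
    forall y, good {j | lt j k} y (F y).
  move=> k; suff /choice[F FP] : forall y, exists c, good {j | lt j k} y c by exists F.
  move=> y; apply: (ex _ (fun j => sval j)) => -[a ja] [b jb] /= ab; exact: eq_exist.
pose pick k := sval (cid (pick_ex k)).
have pickP k : forall y, good {j | lt j k} y (pick k y) := svalP (cid (pick_ex k)).
pose F k (rec : forall j, lt j k -> T) : T :=
  pick k (fun j => rec (sval j) (svalP j)).
pose c := Fix wf (fun=> T) F.
have cE k : c k = pick k (fun j => c (sval j)).
  rewrite /c Fix_eq // => a f g fg; congr (pick a _).
  by apply: funext => j; apply: fg.
exists lt, c; split=> [j k jk|k]; last by rewrite cE; apply: pickP.
by have [Rjk|Rkj] := tot j k; [left|right]; split=> // /esym.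
Qed.

Section Components.
Variables (K : Type) (L : language) (M C : structure L) (i : M -> C).
Hypotheses (limK : strong_limit K) (largeK : sufficiently_large K M).
Hypothesis monsterC : monster K i.
Variables (n : nat) (phi : formula L ('I_n + M)).
Variables (mu : formula L ('I_n + 'I_n + 'I_n + M)).
Variables (G Gstar : groupType) (x : G -> 'I_n -> M) (xstar : Gstar -> 'I_n -> C).
Hypothesis dgM : defines_group (@id M) phi mu x.
Hypothesis dgC : defines_group i phi mu xstar.

Let elem : elementary_embedding i. Proof. by case: monsterC. Qed.
Let emb := embG elem dgM dgC.
Let same := sametype i xstar.

Definition sat1 (a : Gstar) (psi : formula L ('I_n + M)) := sat (join (xstar a) i) psi.
Definition sat2 (a b : Gstar) (psi : formula L ('I_n + 'I_n + M)) :=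
  sat (join (join (xstar a) (xstar b)) i) psi.

Lemma sat1_emb g psi : sat1 (emb g) psi <-> sat (join (x g) id) psi.
Proof.
rewrite (elem _ psi) /sat1 embGE.
by suff -> : (fun v => i (join (x g) id v)) = join (i \o x g) i by []; apply: funext => -[].
Qed.

(** Every type over [M] of an element of the group is finitely satisfiable in
    the group of [M]. *)
Lemma sat1_ex a psi : sat1 a psi -> exists g, sat (join (x g) id) psi.
Proof.
pose swap (w : 'I_n + M) : M + 'I_n := match w with inl k => inr k | inr m => inl m end.
have swapE (N : structure L) (e : M -> N) f : join e f \o swap = join f e.
  by apply: funext => -[].
have [chi chiP] := ex_tuple (rename swap (And phi psi)).
move=> ha; have : sat i chi.
  rewrite chiP; exists (xstar a); rewrite sat_rename swapE; split=> //.
  have : range xstar (xstar a) by exists a.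
  by rewrite (coord_range dgC).
move=> /(elem id); rewrite chiP => -[f]; rewrite sat_rename swapE => -[h1 h2].
have : [set a | sat (join a id) phi] f by [].
by rewrite -(coord_range dgM) => -[g _ gf]; exists g; rewrite gf.
Qed.

(** An element [g] of the group of [M] can be regarded as a parameter. *)
Lemma sat2_emb_same a b g psi : same a b ->
  sat2 a (emb g) psi <-> sat2 b (emb g) psi.
Proof.
pose f (w : 'I_n + 'I_n + M) : 'I_n + M := match w with
  | inl (inl k) => inl k | inl (inr k) => inr (x g k) | inr m => inr m end.
have fE c : join (join (xstar c) (xstar (emb g))) i = join (xstar c) i \o f.
  by apply: funext => -[[k|k]|m] //=; rewrite embGE.
by move=> ab; rewrite /sat2 !fE -(sat_rename f (join (xstar a) i)) -(sat_rename f (join (xstar b) i));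
  apply: ab.
Qed.

Section Coheir.
Variables (a0 : Gstar) (u : set_system G).
Hypotheses (ultra_u : UltraFilter u).
Hypothesis u_type : forall psi, sat1 a0 psi -> u [set g | sat (join (x g) id) psi].

(** [c] realizes, over [M] and the elements [y j], the coheir that the ultrafilter
    [u] defines, for the formulas that involve one of the [y j] at a time; these
    determine the types of the pairs [(y j, c)]. *)
Definition follows (J : Type) (y : J -> Gstar) c := same a0 c /\
  forall j psi, u [set g | sat2 (y j) (emb g) psi] -> sat2 (y j) c psi.

Lemma follows_ex (J : Type) (y : J -> Gstar) : small K J -> exists c, follows y c.
Proof.
move=> sJ; pose W := (J * 'I_n)%type; pose z (w : W) := xstar (y w.1) w.2.
have sW : small K W by apply: small_prod => //; apply: small_fin; case: largeK.
pose f1 (w : 'I_n + M) : 'I_1 * 'I_n + (M + W) :=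
  match w with inl k => inl (ord0, k) | inr m => inr (inl m) end.
pose f2 j (w : 'I_n + 'I_n + M) : 'I_1 * 'I_n + (M + W) := match w with
  | inl (inl k) => inr (inr (j, k)) | inl (inr k) => inl (ord0, k)
  | inr m => inr (inl m) end.
pose T := ({psi | sat1 a0 psi} + {jp : J * formula L ('I_n + 'I_n + M) |
  u [set g | sat2 (y jp.1) (emb g) jp.2]})%type.
pose psi (t : T) := match t with
  | inl p => rename f1 (sval p)
  | inr p => rename (f2 (sval p).1) (sval p).2 end.
have f1E e : join (fun vk => xstar (e vk.1) vk.2) (join i z) \o f1 =
    join (xstar (e ord0)) i.
  by apply: funext => -[].
have f2E e j : join (fun vk => xstar (e vk.1) vk.2) (join i z) \o f2 j =
    join (join (xstar (y j)) (xstar (e ord0))) i.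
  by apply: funext => -[[]|].
have [|e eP] := saturated_group limK largeK monsterC (coord_range dgC) (z := z)
    (psi := psi) sW.
  move=> ts; pose S (t : T) : set G := [set g | match t with
    | inl p => sat (join (x g) id) (sval p)
    | inr p => sat2 (y (sval p).1) (emb g) (sval p).2 end].
  have uS : u [set g | forall t, List.In t ts -> S t g].
    elim: ts => [|t ts IH]; first by apply: filterS filterT => g _.
    have : u (S t) by case: t => -[p hp]; [apply: u_type|].
    move=> /(filterI IH); apply: filterS => g [h1 h2] t' [<-//|]; exact: h1.
  have [g gP] := filter_ex uS.
  exists (fun=> emb g) => t /gP; case: t => -[p hp] /=; rewrite sat_rename.
    by rewrite (f1E (fun=> emb g)) => /sat1_emb.
  by rewrite (f2E (fun=> emb g)).
have sub p : sat1 a0 p -> sat1 (e ord0) p.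
  by move=> h; have := eP (inl (exist _ p h)); rewrite /= sat_rename f1E.
exists (e ord0); split=> [p|j p h]; last first.
  have h' : u [set g | sat2 (y (j, p).1) (emb g) (j, p).2] by [].
  by have := eP (inr (exist _ (j, p) h')); rewrite /= sat_rename f2E.
by split=> [/sub//|h]; apply: contrapT => /(sub (Not p)).
Qed.

Lemma followsE J (y : J -> Gstar) c j psi : follows y c ->
  sat2 (y j) c psi <-> u [set g | sat2 (y j) (emb g) psi].
Proof.
move=> [_ h]; split=> [hc|]; last exact: h.
have [//|nu] := in_ultra_setVsetC [set g | sat2 (y j) (emb g) psi] ultra_u.
by case: (h j (Not psi) nu hc).
Qed.

(** The coheir is invariant over [M], so the type of [(y j, c)] depends only on the
    type of [y j]. *)
Lemma follows_pair J J' (y : J -> Gstar) (y' : J' -> Gstar) c c' j j' psi :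
  follows y c -> follows y' c' -> same (y j) (y' j') ->
  sat2 (y j) c psi <-> sat2 (y' j') c' psi.
Proof.
move=> h h' s; rewrite (followsE _ _ h) (followsE _ _ h').
by have -> : [set g | sat2 (y j) (emb g) psi] = [set g | sat2 (y' j') (emb g) psi]
  by apply/seteqP; split=> g /(sat2_emb_same g psi s).
Qed.

End Coheir.

Lemma coheir_filter a0 : exists u : set_system G, UltraFilter u /\
  forall psi, sat1 a0 psi -> u [set g | sat (join (x g) id) psi].
Proof.
pose F : set_system G := [set X | exists2 psi, sat1 a0 psi &
  [set g | sat (join (x g) id) psi] `<=` X].
have PF : ProperFilter F.
  apply: Build_ProperFilter.
    by move=> [psi /sat1_ex[g hg] /(_ g hg)].
  split.
  - by exists (top _ _) => //; apply: sat_top.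
  - move=> X Y [psi h1 h2] [chi k1 k2]; exists (And psi chi) => // g [/h2 ? /k2 ?].
    by split.
  - by move=> X Y XY [psi h1 h2]; exists psi => // g /h2/XY.
have [u [Uu Fu]] := ultraFilterLemma PF; exists u; split=> // psi h.
by apply: Fu; exists psi.
Qed.

(** By homogeneity an automorphism over [M] moves [(a, c)] to [(a', c')]; it
    respects the group operation. *)
Lemma invariant_sat2 (H : set Gstar) a c a' c' : Defs.invariant i xstar H ->
  (forall psi, sat2 a c psi <-> sat2 a' c' psi) ->
  H (a^-1 * c)%g -> H (a'^-1 * c')%g.
Proof.
move=> invH ee Hac.
have [] := @homogeneous_tuple K L M C i monsterC _
  (join (join (xstar a) (xstar c)) i) (join (join (xstar a') (xstar c')) i).
  by do 2?apply: small_sum => //; try apply: small_fin; case: largeK.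
  exact: ee.
move=> s [autos sz].
have sM m : s (i m) = i m := sz (inr m).
have sa : s \o xstar a = xstar a' by apply: funext => k; exact: (sz (inl (inl k))).
have sc : s \o xstar c = xstar c' by apply: funext => k; exact: (sz (inl (inr k))).
have : (xstar @` H) (s \o xstar (a^-1 * c)%g).
  by rewrite -(invH s autos sM); exists (xstar (a^-1 * c)%g) => //; exists (a^-1 * c)%g.
move=> [h Hh hE]; suff -> : (a'^-1 * c')%g = h by [].
apply: (mulgI a'); rewrite mulVKg; apply/esym/(coord_mul dgC).
have : sat (join (join (join (xstar a) (xstar (a^-1 * c)%g)) (xstar c)) i) mu.
  by apply/(coord_mul dgC); rewrite mulVKg.
move=> /(automorphism_sat _ _ autos).
suff -> : s \o join (join (join (xstar a) (xstar (a^-1 * c)%g)) (xstar c)) i =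
  join (join (join (xstar a') (xstar h)) (xstar c')) i by [].
apply: funext => -[[[k|k]|k]|m]; [ | | |exact: sM].
- exact: (congr1 (@^~ k) sa).
- exact: (congr1 (@^~ k) (esym hE)).
- exact: (congr1 (@^~ k) sc).
Qed.

(** A coheir sequence longer than the index of [H] has two terms [c j], [c k] in
    one coset.  If [c0] realizes the coheir over [a] and [b], then the pairs
    [(a, c0)] and [(b, c0)] have the type of [(c j, c k)], hence [a] and [b] lie
    in the coset of [c0]. *)
Lemma invariant_same (H : set Gstar) : is_subgroup H -> bounded_index K H ->
  Defs.invariant i xstar H -> forall a b, same a b -> H (a^-1 * b)%g.
Proof.
move=> [H1 HM HV] bH invH a b ab.
have [u [Uu u_type]] := coheir_filter a.
pose cosets := [set left_translate g H | g in [set: Gstar]].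
have sQ : small K cosets.
  move: bH; rewrite /small /bounded_index /card_lt.
  by rewrite (card_le_eql (card_setT cosets)) (card_le_eqr (card_setT cosets)).
have natK' : card_lt [set: nat] [set: K] by case: largeK.
have sI : small K (set cosets) := small_set limK sQ.
have [J f y fI|lt [c [tot cP]]] := @wo_recursion (set cosets) Gstar (@follows a u).
  by apply: follows_ex => //; apply: small_inj fI sI.
have inQ g : cosets (left_translate g H) by exists g.
pose f k : cosets := SigSub (mem_set (inQ (c k))).
have [j [k [jk fjk]]] : exists j k, lt j k /\ left_translate (c j) H = left_translate (c k) H.
  apply: contrapT => nf; apply: (@not_injective_set cosets f) => j k.
  move=> /(congr1 val) /= e; apply: contrapT => jk; apply: nf.
  by have [h|h] := tot j k jk; [exists j, k|exists k, j].
have Hjk : H ((c j)^-1 * c k)%g.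
  have : left_translate (c k) H (c k) by exists 1%g; rewrite ?mulg1.
  by rewrite -fjk => -[h Hh <-]; rewrite mulKg.
pose y (t : bool) := if t then a else b.
have [c0 c0P] := follows_ex Uu u_type y (small_fin natK' bool).
have Ht (t : bool) : H ((y t)^-1 * c0)%g.
  apply: invariant_sat2 invH _ Hjk => psi.
  have fp := follows_pair Uu (j := exist _ j jk) (j' := t) psi (cP k) c0P.
  apply: fp.
  have [ac _] := cP j => chi; rewrite -(ac chi).
  by case: t => //=; apply: ab.
have -> : (a^-1 * b = (a^-1 * c0) * (b^-1 * c0)^-1)%g.
  by rewrite invgM invgK !mulgA mulgK.
by apply: HM; [exact: (Ht true)|apply: HV; exact: (Ht false)].
Qed.

Let quotC (q : nat) (theta : nat -> formula L ('I_n + M)) : set Gstar :=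
  @quot L M C i n G Gstar x xstar q theta false.

Definition same_quot : set Gstar := [set g | exists a b, same a b /\ g = (a^-1 * b)%g].

Lemma In_nth T (d t : T) s : List.In t s -> exists2 j, (j < size s)%N & nth d s j = t.
Proof.
elim: s => //= u s IH [->|/IH[j js <-]]; first by exists 0.
by exists j.+1.
Qed.

(** If [y] lies in all the sets on the right, then any finite part of the type
    which says that [y] is the product of four quotients of similar elements is
    realized; the eight elements are the variables [a k] and [b k]. *)
Lemma prod4_same : prod4 same_quot = [set g | forall q theta, prod4 (quotC q theta) g].
Proof.
apply/seteqP; split=> [g [a1 [a2 [a3 [a4 [h1 h2 h3 h4 ->]]]]] q theta|y yP].
  have sub a : same_quot a -> quotC q theta a.
    by move=> [b [c [bc ->]]]; exists b, c; split=> // j _; apply: bc.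
  by exists a1, a2, a3, a4; split=> //; apply: sub.
pose W := 'I_n; pose z := xstar y; pose lift (w : 'I_n + M) : 'I_n + (M + W) :=
  match w with inl k => inl k | inr m => inr (inl m) end.
pose liftmu (w : 'I_n + 'I_n + 'I_n + M) : 'I_n + 'I_n + 'I_n + (M + W) :=
  match w with inl k => inl k | inr m => inr (inl m) end.
have liftE a : join a (join i z) \o lift = join a i by apply: funext => -[].
have liftmuE a : join a (join i z) \o liftmu = join a i by apply: funext => -[].
have dgz (s : unit) : defines_group (join i z) (rename lift phi) (rename liftmu mu) xstar.
  split; first exact: (coord_inj dgC).
    rewrite (coord_range dgC); apply/seteqP; split=> a /=; by rewrite sat_rename liftE.
  by move=> g h k; rewrite sat_rename liftmuE; apply: (coord_mul dgC).
pose p (s : unit) := join i z.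
pose a k : 'I_8 := inord k.*2; pose b k : 'I_8 := inord k.*2.+1.
pose w (e : 'I_8 -> Gstar) (k : nat) := ((e (a k))^-1 * e (b k))%g.
pose Rel (t : option (formula L ('I_n + M))) (e : 'I_8 -> Gstar) := match t with
  | None => (w e 0%N * w e 1%N * w e 2%N * w e 3%N)%g = y
  | Some psi => {in iota 0 4, forall k, sat1 (e (a k)) psi <-> sat1 (e (b k)) psi} end.
have dw k : defterm p (fun _ : unit => xstar) (fun _ (e : 'I_8 -> Gstar) => w e k).
  exact: (defterm_mul dgz (defterm_inv dgz (defterm_var dgz (a k))) (defterm_var dgz (b k))).
have /choice[psi psiP] : forall t, exists psi, forall e : 'I_8 -> Gstar,
    Rel t e <-> sat (join (fun vk => xstar (e vk.1) vk.2) (join i z)) psi.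
  move=> t; suff [psi h] : codef p (fun _ : unit => xstar) (fun _ => Rel t).
    by exists psi => e; apply: (h tt).
  case: t => [psi|] /=.
    have d1 := dset_sat p (fun _ : unit => xstar) (rename lift psi).
    have d2 := codef_all_seq (iota 0 4) (fun k => codef_iff
      (codef_in dgz d1 (defterm_var dgz (a k))) (codef_in dgz d1 (defterm_var dgz (b k)))).
    apply: codef_ext d2 => s e; split=> h k /h; by rewrite /= 2!sat_rename !liftE.
  have cy : parametric p (fun _ : unit => xstar) (fun _ => y).
    by exists inr => s; apply: funext.
  have d1 : dset p (fun _ : unit => xstar) (fun _ => [set y]).
    exact: (codef_rename (fun _ : option unit => tt) (defterm_const dgz unit cy)).
  exact: (codef_in dgz d1 (defterm_mul dgz (defterm_mul dgz (defterm_mul dgz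
    (dw 0) (dw 1)) (dw 2)) (dw 3))).
have sW : small K W by apply: small_fin; case: largeK.
have [ts|e eP] := saturated_group limK largeK monsterC (coord_range dgC) (z := z)
    (psi := psi) sW.
  pose fs := pmap id ts; pose theta := nth (top _ _) fs.
  have [a1 [a2 [a3 [a4 [h1 h2 h3 h4 yE]]]]] := yP (size fs) theta.
  move: h1 h2 h3 h4 yE => [c1 [d1 [e1 ->]]] [c2 [d2 [e2 ->]]] [c3 [d3 [e3 ->]]].
  move=> [c4 [d4 [e4 ->]]] yE.
  pose e (v : 'I_8) := nth 1%g [:: c1; d1; c2; d2; c3; d3; c4; d4] v.
  exists e => t tts; apply: (proj1 (psiP t e)); case: t tts => [chi|] tts /=; last first.
    by rewrite /w /e /a /b !inordK.
  have [j js jE] : exists2 j, (j < size fs)%N & theta j = chi.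
    apply: In_nth; rewrite /fs; elim: (ts) tts => //= -[c|] u IH /= [].
    - by move=> [->]; left.
    - by move=> /IH; right.
    - by [].
    - by move=> /IH.
  have jq : j \in iota 0 (size fs) by rewrite mem_iota.
  move=> k; rewrite -jE /e /a /b; rewrite !inE => /or4P[]/eqP ->; rewrite !inordK //=.
  - exact: e1.
  - exact: e2.
  - exact: e3.
  - exact: e4.
have wS k : (k < 4)%N -> same_quot (w e k).
  move=> k4; exists (e (a k)), (e (b k)); split=> // chi.
  have : Rel (Some chi) e by apply/psiP.
  by apply; rewrite mem_iota.
have : Rel None e by apply/psiP.
by move=> /= <-; exists (w e 0), (w e 1), (w e 2), (w e 3); split=> //; apply: wS.
Qed.

Lemma same_sym a b : same a b -> same b a.
Proof. by move=> ab psi; rewrite (ab psi). Qed.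

Lemma same_quot1 : same_quot 1%g.
Proof. by exists 1%g, 1%g; rewrite mulVg. Qed.

Lemma same_quotV g : same_quot g -> same_quot g^-1%g.
Proof.
move=> [a [b [/same_sym ba ->]]]; exists b, a; rewrite invgM invgK; split=> //.
Qed.

Variable R : realType.
Hypothesis amenable : definably_amenable R x.

Lemma same_quot_prod (gs : seq Gstar) : (forall g, g \in gs -> same_quot g) ->
  prod4 same_quot (foldr (fun g h => g * h)%g 1%g gs).
Proof.
move=> hgs; rewrite prod4_same => q theta.
have [ps psP ->] : exists2 ps : seq (Gstar * Gstar), {in ps, forall r, same r.1 r.2} &
    foldr (fun g h => g * h)%g 1%g gs = pair_prod ps.
  elim: gs hgs => [|g gs IH] hgs; first by exists [::].
  have [|ps psP e] := IH; first by move=> h hg; apply: hgs; rewrite inE hg orbT.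
  have [a [b [ab gE]]] := hgs g (mem_head _ _).
  exists ((a, b) :: ps); last by rewrite /= e gE.
  by move=> r; rewrite inE => /predU1P[->|/psP].
exact: (sametype_prod elem dgM dgC q theta amenable psP).
Qed.

Lemma prod4_subgroup : is_subgroup (prod4 same_quot).
Proof.
split.
- by apply: (same_quot_prod (gs := [::])).
- move=> _ _ [a1 [a2 [a3 [a4 [h1 h2 h3 h4 ->]]]]] [b1 [b2 [b3 [b4 [k1 k2 k3 k4 ->]]]]].
  have := @same_quot_prod [:: a1; a2; a3; a4; b1; b2; b3; b4].
  rewrite /= mulg1 !mulgA; apply=> g.
  by rewrite !inE => /orP[/eqP->//|/orP[/eqP->//|/orP[/eqP->//|/orP[/eqP->//|/or4P[]/eqP->]]]].
- move=> _ [a1 [a2 [a3 [a4 [h1 h2 h3 h4 ->]]]]].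
  exists a4^-1%g, a3^-1%g, a2^-1%g, a1^-1%g; split; try exact: same_quotV.
  by rewrite !invgM !mulgA.
Qed.

Lemma prod4_type_definable : type_definable i xstar (prod4 same_quot).
Proof.
exists [set Y | exists q theta, Y = prod4 (quotC q theta)]; split.
  move=> _ [q [theta ->]].
  have dgf := dgf dgM dgC.
  exact: (dset_definable false (dset_prod4 dgf (quot_dset dgM dgC q theta))).
rewrite prod4_same; apply/seteqP; split=> g h.
  by move=> _ [q [theta ->]]; apply: h.
by move=> q theta; apply: h; exists q, theta.
Qed.

(** The left coset of [g] depends only on the type of [g], which is determined
    by the definable subsets of the group of [M] that belong to it. *)
Lemma prod4_bounded : bounded_index K (prod4 same_quot).
Proof.
have [S1 SM SV] := prod4_subgroup.
pose H := prod4 same_quot.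
pose tp (g : Gstar) : set (set G) := [set Z | exists2 psi, sat1 g psi &
  Z = [set a | sat (join (x a) id) psi]].
have tp_same g h : tp g = tp h -> same g h.
  suff sub g' h' psi : tp g' `<=` tp h' -> sat1 g' psi -> sat1 h' psi.
    by move=> e psi; split; apply: sub; rewrite e.
  move=> s hg; have [|chi hchi E] := s [set a | sat (join (x a) id) psi].
    by exists psi.
  apply: contrapT => npsi; have [|a [h1 h2]] := @sat1_ex h' (And chi (Not psi)).
    by split.
  have : [set a | sat (join (x a) id) psi] a by rewrite E.
  exact: h2.
have cosetE g h : tp g = tp h -> left_translate g H = left_translate h H.
  move=> /tp_same gh.
  have inH : H (g^-1 * h)%g.
    exists (g^-1 * h)%g, 1%g, 1%g, 1%g.
    by rewrite !mulg1; split; [exists g, h|exact: same_quot1..|by []].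
  have inH' : H (h^-1 * g)%g by have := SV _ inH; rewrite invgM invgK.
  apply/seteqP; split=> _ [a Ha <-].
    by exists ((h^-1 * g) * a)%g; [exact: SM|rewrite -mulgA mulVKg].
  by exists ((g^-1 * h) * a)%g; [exact: SM|rewrite -mulgA mulVKg].
have /choice[rep repP] : forall Z, exists g, (exists h, tp h = Z) -> tp g = Z.
  by move=> Z; have [[h hZ]|nZ] := pselect (exists h, tp h = Z); [exists h|exists 1%g].
apply: (@card_le_small K _ (set (set G))); last first.
  do 2!apply: small_set => //; apply: (small_inj (coord_inj dgM)).
  by apply: small_fun => //; case: largeK.
apply: card_le_trans (card_image_le (fun Z => left_translate (rep Z) H) setT).
apply: subset_card_le => _ [g _ <-]; exists (tp g) => //.
by apply: cosetE; apply: repP; exists g.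
Qed.

Lemma type_definable_invariant (H : set Gstar) :
  type_definable i xstar H -> Defs.invariant i xstar H.
Proof.
move=> [F [dF ->]] s autos sM.
have sE c psi : sat (join c i) psi <-> sat (join (s \o c) i) psi.
  rewrite (automorphism_sat _ _ autos).
  suff -> : s \o join c i = join (s \o c) i by [].
  by apply: funext => -[k|m] //; apply: sM.
have FE g h Y : s \o xstar g = xstar h -> F Y -> (Y g <-> Y h).
  move=> gh FY; have [psi ->] := dF _ FY.
  by rewrite /= sE gh.
have ex c : range xstar c <-> range xstar (s \o c).
  by rewrite (coord_range dgC) /= -sE.
have [[s' sK s'K] _ _] := autos.
apply/seteqP; split=> [_ [_ [g gF <-] <-]|_ [g gF <-]].
  have [h _ hE] : range xstar (s \o xstar g) by apply: (proj1 (ex _)); exists g.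
  exists h => // Y FY; apply: (proj1 (FE _ _ _ (esym hE) FY)); exact: gF.
have e : s \o (s' \o xstar g) = xstar g by apply: funext => k /=; rewrite s'K.
have [h _ hE] : range xstar (s' \o xstar g) by apply: (proj2 (ex _)); rewrite e; exists g.
exists (xstar h); last by rewrite -[RHS]e -hE.
exists h => // Y FY; apply: (proj2 (FE h g Y _ FY)); last exact: gF.
by rewrite hE.
Qed.

Lemma components_eq (H00 H000 : set Gstar) :
  is_G00 K i xstar H00 -> is_G000 K i xstar H000 -> H00 = H000.
Proof.
move=> [[sub00 b00 td00] least00] [[sub000 b000 inv000] least000].
apply/seteqP; split; last first.
  by apply: least000; split=> //; apply: type_definable_invariant.
apply: (@subset_trans _ (prod4 same_quot)).
  apply: least00; split; [exact: prod4_subgroup|exact: prod4_bounded|].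
  exact: prod4_type_definable.
have [_ HM _] := sub000.
have sub g : same_quot g -> H000 g.
  by move=> [a [b [ab ->]]]; apply: invariant_same.
move=> _ [a1 [a2 [a3 [a4 [h1 h2 h3 h4 ->]]]]].
exact: (HM _ _ (HM _ _ (HM _ _ (sub _ h1) (sub _ h2)) (sub _ h3)) (sub _ h4)).
Qed.

End Components.

Theorem theorem4p3 (R : realType) (L : language) (M C : structure L)
    (K : Type) (i : M -> C)
    (n : nat) (phi : formula L ('I_n + M))
    (mu : formula L ('I_n + 'I_n + 'I_n + M))
    (G Gstar : groupType) (x : G -> 'I_n -> M) (xstar : Gstar -> 'I_n -> C)
    (H00 H000 : set Gstar) :
  strong_limit K -> sufficiently_large K M -> monster K i ->
  defines_group (@id M) phi mu x ->
  defines_group i phi mu xstar ->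
  definably_amenable R x ->
  is_G00 K i xstar H00 ->
  is_G000 K i xstar H000 ->
  H00 = H000.
Proof.
move=> limK largeK monsterC dgM dgC amenable.
exact: (components_eq limK largeK monsterC dgM dgC amenable).
Qed.
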